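(* Let $K$ be a field, let $n\geq 0$ be an integer, let $S=K[a,b,c,d,x_1,y_1,\ldots,x_n,y_n]$ be the polynomial ring in $2n+4$ variables over $K$, and let $I\subset S$ be the monomial ideal generated by $$a^6,\ a^5b,\ ab^5,\ b^6,\ a^4b^4c,\ a^4b^4d,\ a^4x_1y_1^2,\ b^4x_1^2y_1,\ \ldots,\ a^4x_ny_n^2,\ b^4x_n^2y_n$$ (that is, by the six monomials $a^6, a^5b, ab^5, b^6, a^4b^4c, a^4b^4d$ together with the monomials $a^4x_iy_i^2$ and $b^4x_i^2y_i$ for $1\leq i\leq n$). Then for every integer $k\geq 1$, $$\operatorname{depth}(S/I^k)=\begin{cases}0, & \text{if } k \text{ is odd and } k\leq 2n+1,\\ 1, & \text{if } k \text{ is even and } k\leq 2n,\\ 2, & \text{if } k>2n+1.\end{cases}$$ In particular, the depth function $f(k)=\operatorname{depth}(S/I^k)$, $k\geq 1$, of $I$ has precisely $n$ strict local maxima.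
   Context: For a finitely generated graded $S$-module $M\neq 0$, $\operatorname{depth}(M)$ denotes the depth of $M$ with respect to the graded maximal ideal $\mathfrak{m}=(a,b,c,d,x_1,y_1,\ldots,x_n,y_n)$ of $S$, i.e. the common length of all maximal $M$-regular sequences in $\mathfrak{m}$. The depth function of an ideal $I$ is the numerical function $f(k)=\operatorname{depth}(S/I^k)$, defined for integers $k\geq 1$. A strict local maximum of $f$ is an integer $k\geq 2$ with $f(k-1)<f(k)$ and $f(k)>f(k+1)$. *)

(* Defs.v *)
From HB Require Import structures.
From mathcomp Require Import all_boot all_order all_algebra.
From mathcomp Require Import boolp.
From mathcomp Require Import mpoly.

Set Implicit Arguments.
Unset Strict Implicit.
Unset Printing Implicit Defensive.

Import GRing.Theory.

Local Open Scope ring_scope.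
Local Open Scope quotient_scope.

(* MathComp's ring_quotient gives the quotient of an abelian group by a
   subgroup, but no scalar action on it; quotmod adds the one of R on V / N. *)
Section QuotientModule.
Variables (R : comNzRingType) (V : lmodType R) (N : submodClosed V).

(* submodClosed, being stated over semirings, omits closure under opposite. *)
Definition submod_zmod : {pred V} := N.

Lemma submod_zmod_closed : zmod_closed submod_zmod.
Proof.
split=> [|u v Nu Nv]; first exact: (@rpred0 _ N).
by rewrite -scaleN1r; apply: (@rpredD _ N) => //; apply: (@rpredZ _ _ N).
Qed.

HB.instance Definition _ :=
  GRing.isZmodClosed.Build V submod_zmod submod_zmod_closed.

Definition quotmod : Type := @Quotient.quot V submod_zmod.

HB.instance Definition _ := GRing.Zmodule.on quotmod.

Definition quotmod_proj (v : V) : quotmod := \pi_(@Quotient.quot V submod_zmod) v.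

Lemma quotmod_projP (u v : V) :
  (quotmod_proj u = quotmod_proj v) <-> (u - v \in N).
Proof. by rewrite (Quotient.idealrBE submod_zmod); split=> [/eqP|/eqP]. Qed.

Definition quotmod_scale (a : R) (x : quotmod) : quotmod :=
  quotmod_proj (a *: (repr (x : @Quotient.quot V submod_zmod))).

Lemma quotmod_reprK (x : quotmod) :
  quotmod_proj (repr (x : @Quotient.quot V submod_zmod)) = x.
Proof. exact: reprK. Qed.

Lemma quotmod_projD (u v : V) :
  quotmod_proj (u + v) = quotmod_proj u + quotmod_proj v.
Proof. exact: (@Quotient.pi_add V submod_zmod). Qed.

Lemma quotmod_projZ (a : R) (v : V) :
  quotmod_proj (a *: v) = quotmod_scale a (quotmod_proj v).
Proof.
apply/quotmod_projP; rewrite -scalerBr rpredZ //.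
by apply/quotmod_projP; rewrite quotmod_reprK.
Qed.

Lemma quotmod_scaleA a b x :
  quotmod_scale a (quotmod_scale b x) = quotmod_scale (a * b) x.
Proof. by rewrite -[x]quotmod_reprK -!quotmod_projZ scalerA. Qed.

Lemma quotmod_scale1 : left_id 1 quotmod_scale.
Proof. by move=> x; rewrite -[x]quotmod_reprK -quotmod_projZ scale1r. Qed.

Lemma quotmod_scaleDr : right_distributive quotmod_scale +%R.
Proof.
move=> a x y; rewrite -[x]quotmod_reprK -[y]quotmod_reprK.
by rewrite -quotmod_projD -!quotmod_projZ scalerDr quotmod_projD.
Qed.

Lemma quotmod_scaleDl x : {morph quotmod_scale^~ x : a b / a + b}.
Proof.
move=> a b; rewrite -[x]quotmod_reprK.
by rewrite -!quotmod_projZ scalerDl quotmod_projD.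
Qed.

HB.instance Definition _ := GRing.Zmodule_isLmodule.Build R quotmod
  quotmod_scaleA quotmod_scale1 quotmod_scaleDr quotmod_scaleDl.

End QuotientModule.

Section Ideals.
Variable R : comNzRingType.

Definition ideal_gen (G : R -> Prop) : {pred R^o} :=
  fun p => `[< exists s : seq (R * R),
    (forall t, t \in s -> G t.2) /\ p = \sum_(t <- s) t.1 * t.2 >].

Lemma ideal_gen_submod (G : R -> Prop) : submod_closed (ideal_gen G).
Proof.
split=> [|a p q /asboolP[s [Gs ->]] /asboolP[t [Gt ->]]].
  by apply/asboolP; exists [::]; rewrite big_nil.
apply/asboolP; exists ([seq (a * u.1, u.2) | u <- s] ++ t); split.
  move=> u; rewrite mem_cat => /orP[/mapP[v vs ->]|]; last exact: Gt.
  exact: (Gs v).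
rewrite big_cat big_map /=; congr (_ + _).
rewrite /GRing.scale /= mulr_sumr.
by apply: eq_bigr => u _; rewrite mulrA.
Qed.

HB.instance Definition _ (G : R -> Prop) :=
  GRing.isSubmodClosed.Build R R^o (ideal_gen G) (ideal_gen_submod G).

(* I^k is generated by the k-fold products of elements of I; I^0 = (1). *)
Definition ideal_pow (I : {pred R^o}) (k : nat) : {pred R^o} :=
  ideal_gen (fun p => exists u : 'I_k -> R,
    (forall i, u i \in I) /\ p = \prod_(i < k) u i).

HB.instance Definition _ (I : {pred R^o}) (k : nat) :=
  GRing.SubmodClosed.on (ideal_pow I k).

End Ideals.

Section Depth.
Variables (R : comNzRingType) (M : lmodType R).

(* v lies in the submodule (f_1, ..., f_r) M. *)
Definition in_seq_mul (fs : seq R) (v : M) : Prop :=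
  exists u : nat -> M, v = \sum_(i < size fs) fs`_i *: u i.

(* f_i is a nonzerodivisor on M / (f_1, ..., f_{i-1}) M, expressed on
   representatives, and M / (f_1, ..., f_r) M is nonzero. *)
Definition regular_seq (fs : seq R) : Prop :=
  (forall i v, (i < size fs)%N ->
     in_seq_mul (take i fs) (fs`_i *: v) -> in_seq_mul (take i fs) v) /\
  (exists v, ~ in_seq_mul fs v).

Definition regular_seq_in (m : {pred R}) (fs : seq R) : Prop :=
  {subset fs <= m} /\ regular_seq fs.

Definition maximal_regular_seq_in (m : {pred R}) (fs : seq R) : Prop :=
  regular_seq_in m fs /\ forall f, ~ regular_seq_in m (rcons fs f).

(* d is the common length of all maximal M-regular sequences in m.  This is a
   relation rather than a function so that no default value of the depth is
   needed; the first clause makes d unique. *)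
Definition has_depth (m : {pred R}) (d : nat) : Prop :=
  (exists fs, maximal_regular_seq_in m fs) /\
  (forall fs, maximal_regular_seq_in m fs -> size fs = d).

End Depth.

(* The variables are numbered a, b, c, d, x_1, ..., x_n, y_1, ..., y_n. *)
Notation polyS K n := {mpoly K[4 + (n + n)]}.

Section Example.
Variables (K : fieldType) (n : nat).

Definition var_a : polyS K n := 'X_(lshift (n + n) (@Ordinal 4 0 isT)).
Definition var_b : polyS K n := 'X_(lshift (n + n) (@Ordinal 4 1 isT)).
Definition var_c : polyS K n := 'X_(lshift (n + n) (@Ordinal 4 2 isT)).
Definition var_d : polyS K n := 'X_(lshift (n + n) (@Ordinal 4 3 isT)).
Definition var_x (i : 'I_n) : polyS K n := 'X_(rshift 4 (lshift n i)).
Definition var_y (i : 'I_n) : polyS K n := 'X_(rshift 4 (rshift n i)).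

Definition max_ideal : {pred polyS K n} :=
  ideal_gen (fun p : polyS K n => exists i, p = 'X_i).

Definition gensI : seq (polyS K n) :=
  [:: var_a ^+ 6; var_a ^+ 5 * var_b; var_a * var_b ^+ 5; var_b ^+ 6;
      var_a ^+ 4 * var_b ^+ 4 * var_c; var_a ^+ 4 * var_b ^+ 4 * var_d]
  ++ [seq var_a ^+ 4 * var_x i * var_y i ^+ 2 | i : 'I_n]
  ++ [seq var_b ^+ 4 * var_x i ^+ 2 * var_y i | i : 'I_n].

Definition idealI : {pred (polyS K n)^o} :=
  ideal_gen (fun p : polyS K n => p \in gensI).

Definition quotS_pow (k : nat) : lmodType (polyS K n) :=
  quotmod (ideal_pow idealI k).

Definition depth_quot_pow (k d : nat) : Prop :=
  has_depth (quotS_pow k) max_ideal d.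

End Example.

Arguments max_ideal K n : clear implicits.
Arguments idealI K n : clear implicits.

Definition strict_local_max (f : nat -> nat) (k : nat) : Prop :=
  [/\ (2 <= k)%N, (f k.-1 < f k)%N & (f k.+1 < f k)%N].

(* Main.v *)
(* Write M = S/I^k.  A nonzero i-th Koszul cohomology module of M with respect
   to the variables bounds the length of every M-regular sequence in the graded
   maximal ideal by i, and passing from M to M/fM for an M-regular f lowers the
   index by one; so the depth is pinned down by exhibiting one nonzero class and
   enough regular elements.

   Ignoring x and y, the monomials of the k-th power of (a^6, a^5 b, a b^5, b^6)
   in degree 6k are the a^(6k-t) b^t with t = e + 5 f and e, f <= k; for k <= 3 the
   values t = 4 and t = 6k - 4 are missing.  Because of these gaps, for
   k <= 2n + 1 the power I^k has minimal generators of the form a^4 b^4 c times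
   k - 1 generators involving x and y, no two of them equal, and the same for d.
   For k odd such a generator divided by c, suitably completed, is a socle
   element of M.  For k even, the k - 1 factors leave some index i at which
   exactly one of a^4 x_i y_i^2, b^4 x_i^2 y_i is used, and the variable occurring
   in it with exponent 2 can be multiplied in freely: there is no socle, but for
   k <= 2n there is a monomial outside I^k that all the other variables send into
   I^k.  For k > 2n + 1 two of the k - 1 factors would be equal; then c and d drop
   out of the generators of I^k, whence M = M'[c, d] with M' of depth 0. *)

Require Import Defs.
From mathcomp Require Import all_boot all_order all_algebra.
From mathcomp Require Import boolp mpoly ring zify.

Set Implicit Arguments.
Unset Strict Implicit.
Unset Printing Implicit Defensive.

Import GRing.Theory.

Local Open Scope ring_scope.

(** * Regular sequences and Koszul cohomology *)

Section SeqMul.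
Variables (R : comNzRingType) (M : lmodType R).
Implicit Types (fs : seq R) (u v : M).

Lemma in_seq_mul_nil v : in_seq_mul [::] v <-> v = 0.
Proof.
by split=> [[u ->]|->]; [|exists (fun=> 0)]; rewrite big_ord0.
Qed.

Lemma in_seq_mulD fs u v :
  in_seq_mul fs u -> in_seq_mul fs v -> in_seq_mul fs (u + v).
Proof.
move=> [a ->] [b ->]; exists (fun i => a i + b i).
by rewrite -big_split; apply: eq_bigr => i _; rewrite scalerDr.
Qed.

Lemma in_seq_mulZ fs c v : in_seq_mul fs v -> in_seq_mul fs (c *: v).
Proof.
move=> [a ->]; exists (fun i => c *: a i).
by rewrite scaler_sumr; apply: eq_bigr => i _; rewrite !scalerA mulrC.
Qed.

Lemma in_seq_mulB fs u v :
  in_seq_mul fs u -> in_seq_mul fs v -> in_seq_mul fs (u - v).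
Proof.
by move=> fu fv; rewrite -scaleN1r; apply/in_seq_mulD/in_seq_mulZ.
Qed.

Lemma in_seq_mul0 fs : in_seq_mul fs (0 : M).
Proof. by exists (fun=> 0); rewrite big1 // => i _; rewrite scaler0. Qed.

Lemma in_seq_mul_sum (I : Type) (r : seq I) fs (F : I -> M) :
  (forall i, in_seq_mul fs (F i)) -> in_seq_mul fs (\sum_(i <- r) F i).
Proof.
by move=> FP; elim/big_ind: _ => //; [apply: in_seq_mul0|apply: in_seq_mulD].
Qed.

Lemma in_seq_mul_rcons fs f v :
  in_seq_mul (rcons fs f) v <-> exists u, in_seq_mul fs (v - f *: u).
Proof.
have E (a : nat -> M) : \sum_(i < size (rcons fs f)) (rcons fs f)`_i *: a i
    = \sum_(i < size fs) fs`_i *: a i + f *: a (size fs).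
  rewrite size_rcons big_ord_recr /= nth_rcons ltnn eqxx; congr (_ + _).
  by apply: eq_bigr => i _; rewrite nth_rcons ltn_ord.
split=> [[a ->]|[u [a av]]].
  by exists (a (size fs)), a; rewrite E addrK.
pose b i := if i == size fs then u else a i.
exists b; rewrite E {2}/b eqxx -[v](subrK (f *: u)) av; congr (_ + _).
by apply: eq_bigr => i _; rewrite /b ltn_eqF.
Qed.

Lemma in_seq_mul1 f v : in_seq_mul [:: f] v <-> exists u, v = f *: u.
Proof.
rewrite -[[:: f]]/(rcons [::] f) in_seq_mul_rcons.
split=> -[u]; first by move=> /in_seq_mul_nil/eqP; rewrite subr_eq0 => /eqP; exists u.
by move=> ->; exists u; apply/in_seq_mul_nil; rewrite subrr.
Qed.

End SeqMul.

Section Koszul.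
Variables (R : comNzRingType) (M : lmodType R) (N : nat) (X : 'I_N -> R).
Variable m : {pred R}.
Hypothesis m_gen : forall f, f \in m -> exists c : 'I_N -> R, f = \sum_i c i * X i.
Implicit Types (fs : seq R) (f g : R) (u v : M).

(* [koszul_i fs] says that the [i]-th cohomology of the Koszul cochain complex
   of [X] with coefficients in [M / (fs) M] is nonzero. *)
Definition koszul0 fs := exists u : M,
  ~ in_seq_mul fs u /\ forall i, in_seq_mul fs (X i *: u).

Definition koszul1 fs := exists z : 'I_N -> M,
  (forall i j, in_seq_mul fs (X i *: z j - X j *: z i)) /\
  ~ exists t, forall i, in_seq_mul fs (z i - X i *: t).

(* The cocycle condition is written so that it also encodes the antisymmetry
   [z i j = - z j i]. *)
Definition koszul2 fs := exists z : 'I_N -> 'I_N -> M,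
  (forall i j k, in_seq_mul fs (X i *: z j k - X k *: z j i - X j *: z i k)) /\
  ~ exists t, forall i j, in_seq_mul fs (z i j - (X i *: t j - X j *: t i)).

Definition nonzerodivisor_mod fs f :=
  forall v, in_seq_mul fs (f *: v) -> in_seq_mul fs v.

Lemma koszul0_zerodivisor fs f : f \in m -> koszul0 fs -> ~ nonzerodivisor_mod fs f.
Proof.
move=> /m_gen[c ->] [u [nu Xu]] /(_ u) H; apply/nu/H.
rewrite scaler_suml; apply: in_seq_mul_sum => i.
by rewrite -scalerA; apply/in_seq_mulZ.
Qed.

(* If [f = \sum_i c i * X i], multiplication by [f] is null-homotopic on the
   Koszul complex, the homotopy being contraction with [c]. *)
Lemma koszul1_mod fs f : f \in m -> nonzerodivisor_mod fs f ->
  koszul1 fs -> koszul0 (rcons fs f).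
Proof.
move=> /m_gen[c fE] freg [z [zcoc zcob]].
have key i : in_seq_mul fs (X i *: (\sum_j c j *: z j) - f *: z i).
  rewrite fE scaler_suml scaler_sumr -sumrB; apply: in_seq_mul_sum => j.
  rewrite scalerA mulrC -!scalerA -scalerBr; exact/in_seq_mulZ.
exists (\sum_j c j *: z j); split=> [|i]; last first.
  by apply/in_seq_mul_rcons; exists (z i).
move=> /in_seq_mul_rcons[t ht]; apply: zcob; exists t => i; apply: freg.
rewrite scalerBr scalerA mulrC -scalerA.
have := in_seq_mulB (in_seq_mulZ (X i) ht) (key i).
by rewrite scalerBr opprB addrC addrA subrK.
Qed.

Lemma koszul2_mod fs f : f \in m -> nonzerodivisor_mod fs f ->
  koszul2 fs -> koszul1 (rcons fs f).
Proof.
move=> /m_gen[c fE] freg [z [zcoc zcob]].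
pose y j := \sum_i c i *: z i j.
have key i j : in_seq_mul fs (X i *: y j - X j *: y i - f *: z i j).
  rewrite fE scaler_suml !scaler_sumr -!sumrB; apply: in_seq_mul_sum => k.
  rewrite !scalerA ![X _ * _]mulrC -!scalerA -!scalerBr; exact/in_seq_mulZ.
exists y; split=> [i j|].
  by apply/in_seq_mul_rcons; exists (z i j).
move=> [t ht]; apply: zcob.
(* Modulo [fs] this gives [f *: s i = y i - X i *: t], so [f] times the coboundary of [s] agrees
   with [f *: z i j]; cancelling [f] makes [z] a coboundary. *)
have /choice[s hs] : forall i, exists u, in_seq_mul fs (y i - X i *: t - f *: u).
  by move=> i; apply/in_seq_mul_rcons.
exists s => i j; apply: freg.
have := in_seq_mulB
  (in_seq_mulB (in_seq_mulZ (X i) (hs j)) (in_seq_mulZ (X j) (hs i))) (key i j).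
congr in_seq_mul.
rewrite !scalerBr !scalerA [X j * X i]mulrC ![_ * f]mulrC.
set A := X i *: y j; set B := X j *: y i; set C := (X i * X j) *: t.
set D := (f * X i) *: _; set E := (f * X j) *: _; set F := f *: z i j.
have -> : A - C - D - (B - C - E) = A - B - (D - E).
  rewrite [- (B - C - E)]opprD opprK addrACA [- (B - C)]opprB [A - C + _]addrA.
  by rewrite subrK [- (D - E)]opprB [E - D]addrC.
by rewrite [- (A - B - F)]opprB addrC addrA subrK.
Qed.

Lemma regular_seq1 f : nonzerodivisor_mod [::] f ->
  (exists v, ~ in_seq_mul [:: f] v) -> regular_seq M [:: f].
Proof. by move=> fr nz; split=> // -[|i] v //= _; apply: fr. Qed.

Lemma regular_seq2 f g : nonzerodivisor_mod [::] f -> nonzerodivisor_mod [:: f] g ->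
  (exists v, ~ in_seq_mul [:: f; g] v) -> regular_seq M [:: f; g].
Proof. by move=> fr gr nz; split=> // -[|[|i]] v //= _; [apply: fr|apply: gr]. Qed.

Lemma regular_seq_nth fs i : regular_seq M fs -> (i < size fs)%N ->
  nonzerodivisor_mod (take i fs) fs`_i.
Proof. by move=> [reg _] ifs v; apply: reg. Qed.

Lemma koszul0_neq0 fs : koszul0 fs -> exists v, ~ in_seq_mul fs v.
Proof. by move=> [u [nu _]]; exists u. Qed.

Lemma koszul0_maximal fs : koszul0 fs -> regular_seq_in M m fs ->
  maximal_regular_seq_in M m fs.
Proof.
move=> k0 fsreg; split=> // f [fm freg].
have /= := regular_seq_nth (i := size fs) freg.
rewrite size_rcons ltnSn nth_rcons ltnn eqxx -cats1 take_size_cat // => /(_ isT).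
by apply: koszul0_zerodivisor => //; apply: fm; rewrite mem_rcons mem_head.
Qed.

Lemma has_depth0 : koszul0 [::] -> has_depth M m 0.
Proof.
move=> k0; split.
  exists [::]; apply: koszul0_maximal => //; split=> //; split=> //.
  exact: koszul0_neq0.
move=> [|f fs] // [[fm freg] _]; exfalso.
apply: (koszul0_zerodivisor (f := f) _ k0); first by apply: fm; rewrite mem_head.
exact: (regular_seq_nth (i := 0) freg).
Qed.

(** Each regular element of [m] turns the class in degree 1 into one in degree 0, so every regular
    sequence of length one is maximal; [f] shows that the empty one is not. *)
Lemma has_depth1 f : koszul1 [::] -> f \in m -> nonzerodivisor_mod [::] f ->
  has_depth M m 1.
Proof.
move=> k1 fm fr.
have reg1 g : g \in m -> nonzerodivisor_mod [::] g ->
    koszul0 [:: g] /\ regular_seq_in M m [:: g].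
  move=> gm gr; have k0 := koszul1_mod gm gr k1; split=> //; split.
    by move=> h; rewrite inE => /eqP->.
  exact/regular_seq1/koszul0_neq0.
split; first by exists [:: f]; apply: koszul0_maximal; have [] := reg1 _ fm fr.
move=> [|g [|h fs]] // [[gm greg] gmax]; exfalso.
  by apply: (gmax f); have [] := reg1 _ fm fr.
have gm' : g \in m by apply: gm; rewrite mem_head.
have [k0 _] := reg1 _ gm' (regular_seq_nth (i := 0) greg isT).
apply: (koszul0_zerodivisor (f := h) _ k0).
  by apply: gm; rewrite !inE eqxx orbT.
exact: (regular_seq_nth (i := 1) greg).
Qed.

(** [has_depth] concerns all maximal regular sequences, so one of length two is not enough: the last
    hypothesis excludes maximal ones of length one, the Koszul class excludes length three and
    more. *)
Lemma has_depth2 f : koszul2 [::] -> f \in m -> nonzerodivisor_mod [::] f ->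
  (forall g, g \in m -> nonzerodivisor_mod [::] g ->
    exists2 h, h \in m & nonzerodivisor_mod [:: g] h) ->
  has_depth M m 2.
Proof.
move=> k2 fm fr extend.
have reg1 g : g \in m -> nonzerodivisor_mod [::] g ->
    koszul1 [:: g].
  by move=> gm gr; apply: (koszul2_mod gm gr k2).
have reg2 g h : g \in m -> nonzerodivisor_mod [::] g ->
    h \in m -> nonzerodivisor_mod [:: g] h ->
    koszul0 [:: g; h] /\ regular_seq_in M m [:: g; h].
  move=> gm gr hm hr; have k0 := koszul1_mod hm hr (reg1 g gm gr); split=> //; split.
    by move=> e; rewrite !inE => /orP[]/eqP->.
  exact/regular_seq2/koszul0_neq0.
have reg1' g : g \in m -> nonzerodivisor_mod [::] g -> exists h,
    koszul0 [:: g; h] /\ regular_seq_in M m [:: g; h].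
  move=> gm gr; have [h hm hr] := extend g gm gr; exists h; exact: reg2.
split.
  have [h [k0 reg]] := reg1' _ fm fr.
  by exists [:: f; h]; apply: koszul0_maximal.
move=> [|g [|h [|e fs]]] // [[gm greg] gmax]; exfalso.
- apply: (gmax f); have [h [_ [hm hr]]] := reg1' _ fm fr.
  split; first by move=> e; rewrite inE => /eqP->.
  apply: regular_seq1 => //; have [v nv] := hr.2.
  exists v => fv; apply: nv; apply/(@in_seq_mul_rcons _ _ [:: f] h).
  by exists 0; rewrite scaler0 subr0.
- have gm' : g \in m by apply: gm; rewrite mem_head.
  have [h [_ reg]] := reg1' _ gm' (regular_seq_nth (i := 0) greg isT).
  exact: (gmax h).
have gm' : g \in m by apply: gm; rewrite mem_head.
have hm' : h \in m by apply: gm; rewrite !inE eqxx orbT.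
have [k0 _] := reg2 _ _ gm' (regular_seq_nth (i := 0) greg isT)
                        hm' (regular_seq_nth (i := 1) greg isT).
apply: (koszul0_zerodivisor (f := e) _ k0).
  by apply: gm; rewrite !inE eqxx !orbT.
exact: (regular_seq_nth (i := 2) greg).
Qed.

End Koszul.

Lemma has_depth_inj (R : comNzRingType) (M : lmodType R) (m : {pred R}) d e :
  has_depth M m d -> has_depth M m e -> d = e.
Proof. by move=> [[fs fsmax] dP] [_ eP]; rewrite -(dP fs) // (eP fs). Qed.

(** * Monomial ideals *)

Section MonomialIdeal.
Variables (K : fieldType) (N : nat).
Local Notation S := {mpoly K[N]}.
Variable J : submodClosed S^o.
Hypothesis J_mono : forall p : S, p \in J <-> {in msupp p, forall m, 'X_[m] \in J}.
Implicit Types (p q f v : S) (m w : 'X_{1..N}).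

Lemma ideal_mulr p q : q \in J -> p * q \in J.
Proof. exact: (@rpredZ _ S^o J p q). Qed.

Lemma ideal_memB p q : p \in J -> q \in J -> p - q \in J.
Proof. exact: (submod_zmod_closed J).2. Qed.

Lemma ideal_mnmD m w : 'X_[w] \in J -> 'X_[m + w] \in J.
Proof. by rewrite mpolyXD; apply: ideal_mulr. Qed.

Definition mrestrict (A : pred 'X_{1..N}) p : S :=
  \sum_(m <- [seq m <- msupp p | A m]) p@_m *: 'X_[m].

Lemma msupp_mrestrict A p m :
  (m \in msupp (mrestrict A p)) = (m \in msupp p) && A m.
Proof.
rewrite (perm_mem (msupp_sumX (f := fun k => p@_k) _ _)).
- by rewrite mem_filter andbC.
- exact: filter_uniq (msupp_uniq p).
by move=> k; rewrite mem_filter mcoeff_msupp => /andP[].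
Qed.

Lemma mrestrictC (A : pred 'X_{1..N}) p :
  p = mrestrict A p + mrestrict (predC A) p.
Proof. by rewrite {1}[p]mpolyE /mrestrict !big_filter [LHS](bigID A). Qed.

Lemma mrestrict_neq0 (A : pred 'X_{1..N}) p m :
  m \in msupp p -> A m -> mrestrict A p != 0.
Proof.
move=> mp Am; rewrite -msupp_eq0; apply/negP => /eqP E.
by have := msupp_mrestrict A p m; rewrite E mp Am.
Qed.

Lemma notin_monomial_ideal p : p \notin J ->
  exists2 m, m \in msupp p & 'X_[m] \notin J.
Proof.
move=> pJ; suff /hasP[m] : has (fun m => 'X_[m] \notin J) (msupp p) by exists m.
apply: contraNT pJ; rewrite -all_predC => /allP h.
by apply/J_mono => m /h /=; rewrite negbK.
Qed.

(* A monomial analogue of McCoy's theorem on zero divisors.  Take [v] with the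
   fewest monomials outside [J].  If [m] is the largest monomial of [f] with
   ['X_[m] * v \notin J], and [w] the largest one of [v] outside [J], then
   [m + w] cannot cancel in [f * v], so ['X_[m] * v] has fewer monomials. *)
Lemma monomial_mccoy f v : f * v \in J -> v \notin J ->
  exists2 w, 'X_[w] \notin J & {in msupp f, forall m, 'X_[m + w] \in J}.
Proof.
have [k] := ubnP (count (fun m => 'X_[m] \notin J) (msupp v)).
elim: k v => // k IHk v /ltnSE lek fvJ vJ.
pose A m := 'X_[m] * v \notin J.
have [/hasP[m0 m0f Am0] | /hasPn fA] := boolP (has A (msupp f)); last first.
  have [w wv wJ] := notin_monomial_ideal vJ; exists w => // m /fA.
  rewrite negbK => /J_mono; apply.
  by rewrite mulrC (perm_mem (msuppMX _ _)); apply/mapP; exists w.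
pose B w := 'X_[w] \notin J.
have [w0 w0v Bw0] := notin_monomial_ideal vJ.
pose f1 := mrestrict A f; pose v1 := mrestrict B v.
have f1_neq0 : f1 != 0 by apply: mrestrict_neq0 Am0.
have v1_neq0 : v1 != 0 by apply: mrestrict_neq0 Bw0.
(* The discarded monomials of [f] multiply [v] into [J], and those of [v] lie in [J] themselves. *)
have f1v1J : f1 * v1 \in J.
  have -> : f1 * v1 =
      f * v - (mrestrict (predC A) f * v + f1 * mrestrict (predC B) v).
    have := mrestrictC A f; have := mrestrictC B v; rewrite -/f1 -/v1.
    by move: (mrestrict (predC A) f) (mrestrict (predC B) v) => f0 v0 -> ->; ring.
  apply: ideal_memB => //; apply: (@rpredD _ J).
    rewrite mulr_suml big_filter big_seq_cond.
    apply: (@rpred_sum _ J) => m /andP[_]; rewrite /= negbK => mJ.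
    by rewrite -scalerAl -mul_mpolyC; apply: ideal_mulr.
  by apply/ideal_mulr/J_mono => m; rewrite msupp_mrestrict /= negbK => /andP[].
have mwJ : 'X_[mlead f1 + mlead v1] \in J.
  move/J_mono: f1v1J; apply; rewrite -mleadM //.
  by apply: mlead_supp; rewrite mulf_neq0.
have := mlead_supp f1_neq0; rewrite msupp_mrestrict => /andP[mf Am].
have := mlead_supp v1_neq0; rewrite msupp_mrestrict => /andP[wv Bw].
apply: (IHk ('X_[mlead f1] * v)) => //; last first.
  by rewrite mulrCA; apply: ideal_mulr.
rewrite mulrC (permP (msuppMX _ _)) count_map; apply: leq_trans lek.
(* The monomials of ['X_[mlead f1] * v] outside [J] come from monomials of [v] outside [J], and [w]
   is not among these, by [mwJ]. *)
set a := preim _ _; set w := mlead v1 in mwJ wv Bw *.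
have <- : (count (predU a (pred1 w)) (msupp v) = (count a (msupp v)).+1)%N.
  have := count_predUI a (pred1 w) (msupp v).
  rewrite (count_uniq_mem _ (msupp_uniq v)) wv addn1 => <-.
  rewrite [count (predI _ _) _](eq_count (a2 := pred0)) ?count_pred0 ?addn0 //.
  move=> x /=.
  by have [->|] := eqVneq x w; rewrite ?andbF // mwJ.
apply: sub_count => x /= /orP[|/eqP->//].
exact/contra/ideal_mnmD.
Qed.

End MonomialIdeal.

(** * Kronecker substitution of a power of one variable for another *)

Section VariableSubst.
Variables (R : comNzRingType) (N : nat) (c d : 'I_N) (e : nat).
Local Notation S := {mpoly R[N]}.
Implicit Types (m w : 'X_{1..N}) (p q : S).

Definition mnm_erase m : 'X_{1..N} :=
  [multinom (if i == c then 0 else m i)%N | i < N].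

(* Exponents under the Kronecker substitution [X_c := X_d ^ e], which is
   injective on the monomials of degree less than [e]. *)
Definition mnm_subst m : 'X_{1..N} := (mnm_erase m + U_(d) *+ (e * m c))%MM.

Definition var_subst p : S :=
  p \mPo [tuple if i == c then 'X_d ^+ e else 'X_i | i < N].

Lemma mnm_substE m j :
  mnm_subst m j = ((j != c) * m j + (j == d) * (e * m c))%N.
Proof.
rewrite mnmDE mnmE mulmnE mnm1E [d == j]eq_sym.
by case: (j == c); rewrite ?mul1n ?mul0n.
Qed.

Lemma mpolyX_erase m : 'X_[m] = 'X_[mnm_erase m] * 'X_c ^+ m c :> S.
Proof.
rewrite mpolyXn -mpolyXD; congr 'X_[_]; apply/mnmP => j.
rewrite mnmDE mnmE mulmnE mnm1E [c == j]eq_sym.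
by have [->|] := eqVneq j c; rewrite ?mul1n ?add0n ?mul0n ?addn0.
Qed.

Lemma var_substX m : var_subst 'X_[m] = 'X_[mnm_subst m].
Proof.
rewrite /var_subst comp_mpolyX mpolyXD -mpolyXn exprM ['X_[mnm_erase m]]mpolyXE_id.
rewrite (bigD1 c) // [in RHS](bigD1 c) //= tnth_mktuple mnmE eqxx.
rewrite expr0 mul1r mulrC; congr (_ * _).
by apply: eq_bigr => i /negPf ic; rewrite tnth_mktuple mnmE ic.
Qed.

Lemma var_substE p : var_subst p = \sum_(m <- msupp p) p@_m *: 'X_[mnm_subst m].
Proof.
rewrite /var_subst {1}[p]mpolyE raddf_sum; apply: eq_bigr => m _ /=.
by rewrite linearZ /= -var_substX.
Qed.

Lemma var_substM p q : var_subst (p * q) = var_subst p * var_subst q.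
Proof. exact: rmorphM. Qed.

Lemma var_substB p q : var_subst (p - q) = var_subst p - var_subst q.
Proof. exact: rmorphB. Qed.

(** On each monomial, X_c^k - (X_d^e)^k is divisible by X_c - X_d^e. Together with [var_subst_eq0]
    this identifies the kernel of the substitution. *)
Lemma sub_var_subst p : exists q, p - var_subst p = ('X_c - 'X_d ^+ e) * q.
Proof.
rewrite var_substE {1}[p]mpolyE -sumrB.
elim/big_ind: _ => [|_ _ [u ->] [v ->]|m _]; first by exists 0; rewrite mulr0.
  by exists (u + v); rewrite mulrDr.
rewrite -scalerBr mpolyX_erase mpolyXD -mpolyXn exprM -mulrBr subrXX.
by rewrite scalerAl mulrCA; eexists.
Qed.

Hypothesis cd : c != d.

Lemma var_subst_eq0 : var_subst ('X_c - 'X_d ^+ e) = 0.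
Proof.
rewrite var_substB mpolyXn !var_substX.
rewrite (_ : mnm_subst U_(c) = mnm_subst (U_(d) *+ e)) ?subrr //.
apply/mnmP => j; rewrite !mnm_substE !mulmnE !mnm1E eqxx [c == j]eq_sym.
rewrite [d == j]eq_sym [d == c]eq_sym (negPf cd) ?muln0 ?muln1.
have [->|_] := eqVneq j c; first by rewrite (negPf cd).
by rewrite /= add0n !mul1n addn0.
Qed.

(** No cancellation occurs: exponents of X_d in [p] are below [e], so [m d] and [m c] are recovered
    from [m d + e * m c] by division with remainder. *)
Lemma msupp_var_subst p m : (msize p <= e)%N -> m \in msupp p ->
  mnm_subst m \in msupp (var_subst p).
Proof.
move=> pe mp; rewrite mcoeff_msupp var_substE raddf_sum /=.
rewrite (bigD1_seq m) ?msupp_uniq //= mcoeffZ mcoeffX eqxx mulr1.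
rewrite big_seq_cond big1 ?addr0 -?mcoeff_msupp // => w /andP[wp wm].
rewrite mcoeffZ mcoeffX; case: eqP => [E|]; last by rewrite mulr0.
case/eqP: wm; have lt_e z : z \in msupp p -> (z d < e)%N.
  move=> /msize_mdeg_lt zp; apply: leq_trans pe; apply: leq_ltn_trans zp.
  by rewrite mdegE (bigD1 d) //= leq_addr.
have Ed : (w d + e * w c = m d + e * m c)%N.
  by move/mnmP/(_ d): E; rewrite !mnm_substE eqxx eq_sym cd !mul1n.
have wdm : w d = m d.
  have modE z : z \in msupp p -> ((z d + e * z c) %% e = z d)%N.
    by move=> /lt_e ze; rewrite addnC mulnC modnMDl modn_small.
  by rewrite -(modE w) // Ed modE.
have wcm : w c = m c.
  have := lt_e _ mp; move: Ed; rewrite wdm => /addnI/eqP.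
  by rewrite eqn_mul2l => /orP[/eqP->|/eqP].
apply/mnmP => j; move/mnmP/(_ j): E; rewrite !mnm_substE.
have [->|_] := eqVneq j c; first by [].
have [->|_] := eqVneq j d; first by [].
by rewrite !mul1n !mul0n !addn0.
Qed.

End VariableSubst.

(** * Koszul classes and regular elements modulo a monomial ideal *)

Section MonomialQuotient.
Variables (K : fieldType) (N : nat).
Local Notation S := {mpoly K[N]}.
Variable J : submodClosed S^o.
Hypothesis J_mono : forall p : S, p \in J <-> {in msupp p, forall m, 'X_[m] \in J}.
Implicit Types (p q f v : S) (m w : 'X_{1..N}).
Local Notation M := (quotmod J).
Local Notation X := (fun i : 'I_N => 'X_i : S).

Lemma quotmod_proj_surj (x : M) : exists p : S, x = quotmod_proj J p.
Proof. by rewrite -[x]quotmod_reprK; eexists. Qed.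

Lemma scale_quotmod_proj f p : f *: (quotmod_proj J p : M) = quotmod_proj J (f * p).
Proof. exact/esym/quotmod_projZ. Qed.

Lemma quotmod_projB p q : quotmod_proj J (p - q) = quotmod_proj J p - quotmod_proj J q.
Proof.
by rewrite -[- quotmod_proj _ _]scaleN1r scale_quotmod_proj mulN1r -quotmod_projD.
Qed.

Lemma quotmod_proj_eq0 p : quotmod_proj J p = 0 <-> p \in J.
Proof.
have <- : quotmod_proj J 0 = 0 by rewrite -(subrr 0) quotmod_projB subrr.
by rewrite quotmod_projP subr0.
Qed.

Lemma nonzerodivisor_quot f : (forall p, f * p \in J -> p \in J) ->
  nonzerodivisor_mod M [::] f.
Proof.
move=> fr v; have [p ->] := quotmod_proj_surj v.
rewrite scale_quotmod_proj => /in_seq_mul_nil/quotmod_proj_eq0/fr pJ.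
exact/in_seq_mul_nil/quotmod_proj_eq0.
Qed.

Lemma nonzerodivisor_quotE f : nonzerodivisor_mod M [::] f ->
  forall p, f * p \in J -> p \in J.
Proof.
move=> fr p fpJ; apply/quotmod_proj_eq0/in_seq_mul_nil/fr/in_seq_mul_nil.
by rewrite scale_quotmod_proj; apply/quotmod_proj_eq0.
Qed.

Lemma in_seq_mul1_quot f p :
  in_seq_mul [:: f] (quotmod_proj J p : M) <-> exists q, p - f * q \in J.
Proof.
rewrite in_seq_mul1; split=> [[u]|[q pq]].
  have [q ->] := quotmod_proj_surj u => pE; exists q; apply/quotmod_proj_eq0.
  by rewrite quotmod_projB pE scale_quotmod_proj subrr.
exists (quotmod_proj J q); apply/eqP; rewrite scale_quotmod_proj -subr_eq0.
by rewrite -quotmod_projB; apply/eqP/quotmod_proj_eq0.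
Qed.

Lemma koszul0_monomial w : 'X_[w] \notin J ->
  (forall i, 'X_[U_(i) + w] \in J) -> koszul0 M X [::].
Proof.
move=> /negP wJ Xw; exists (quotmod_proj J 'X_[w]); split=> [|i].
  by move=> /in_seq_mul_nil/quotmod_proj_eq0.
apply/in_seq_mul_nil; rewrite scale_quotmod_proj.
by apply/quotmod_proj_eq0; rewrite -mpolyXD.
Qed.

(** The cocycle is X_i X^w at index [i] and 0 elsewhere. If it were the coboundary of [t], index [i]
    would force coefficient 1 at [w] in [t], and then X_j [t] could not vanish modulo [J]. *)
Lemma koszul1_monomial i w : 'X_[U_(i) + w] \notin J ->
  (forall j, j != i -> 'X_[U_(j) + (U_(i) + w)] \in J) ->
  (exists2 j, j != i & 'X_[U_(j) + w] \notin J) -> koszul1 M X [::].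
Proof.
move=> iwJ Xiw [j ji jwJ].
pose u : M := quotmod_proj J 'X_[U_(i) + w].
have Xu k : k != i -> 'X_k *: u = 0.
  move=> ki; rewrite scale_quotmod_proj -mpolyXD.
  exact/quotmod_proj_eq0/Xiw.
exists (fun k => if k == i then u else 0); split=> [k l|[t tP]].
  apply/in_seq_mul_nil; have [->|ki] := eqVneq k i; last first.
    by case: eqVneq => [_|_]; rewrite ?Xu ?scaler0 ?subrr.
  have [->|li] := eqVneq l i; first by rewrite subrr.
  by rewrite scaler0 Xu ?subrr.
have [p tp] := quotmod_proj_surj t.
move: (tP i) (tP j); rewrite eqxx (negPf ji) sub0r tp !scale_quotmod_proj.
rewrite /u -quotmod_projB -[- quotmod_proj _ _]scaleN1r scale_quotmod_proj.
move=> /in_seq_mul_nil/quotmod_proj_eq0/J_mono/(_ (U_(i) + w)%MM) ip.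
move=> /in_seq_mul_nil/quotmod_proj_eq0/J_mono/(_ (U_(j) + w)%MM) jp.
have wp : p@_w = 1.
  apply/eqP; rewrite eq_sym -subr_eq0 -(negbK (_ == 0)); apply: contra iwJ => wp.
  by apply: ip; rewrite mcoeff_msupp mcoeffB mcoeffX eqxx mulrC mcoeffMX.
case/negP: jwJ; apply: jp.
by rewrite mulN1r mcoeff_msupp mcoeffN oppr_eq0 mulrC mcoeffMX wp oner_neq0.
Qed.

(** The cocycle is X^w on the pair (c, d), extended antisymmetrically. A coboundary takes there the
    value X_c t_d - X_d t_c, which has coefficient 0 at [w] because [w] involves neither
    variable. *)
Lemma koszul2_monomial c d w : c != d -> w c = 0 -> w d = 0 ->
  'X_[w] \notin J -> (forall i, i != c -> i != d -> 'X_[U_(i) + w] \in J) ->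
  koszul2 M X [::].
Proof.
move=> cd wc wd wJ Xw.
pose u : M := quotmod_proj J 'X_[w].
have Xu k : k != c -> k != d -> 'X_k *: u = 0.
  move=> kc kd; rewrite scale_quotmod_proj -mpolyXD.
  exact/quotmod_proj_eq0/Xw.
pose z k l : M := if (k == c) && (l == d) then u else
                  if (k == d) && (l == c) then - u else 0.
have zXu k l i : i != c -> i != d -> 'X_i *: z k l = 0.
  move=> ic id; rewrite /z; case: ifP => _; first exact: Xu.
  by case: ifP => _; rewrite ?scalerN ?Xu ?scaler0 ?oppr0.
have zcc : z c c = 0 by rewrite /z (negPf cd) !andbF.
have zdd : z d d = 0 by rewrite /z eq_sym (negPf cd) andbF.
have zcd : z c d = u by rewrite /z !eqxx.
have zdc : z d c = - u by rewrite /z eq_sym (negPf cd) !eqxx.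
have z0 k l : k != c -> k != d -> z k l = 0 by rewrite /z => /negPf-> /negPf->.
have z0' k l : k != c -> k != d -> z l k = 0.
  by rewrite /z => /negPf-> /negPf->; rewrite !andbF.
exists z; split=> [i j k|[t tP]].
  apply/in_seq_mul_nil.
  (* Either all three indices lie in {c, d}, where antisymmetry suffices, or one index lies outside
     and every term vanishes. *)
  have [ijk|] := boolP (all (fun l => (l == c) || (l == d)) [:: i; j; k]).
    have /and4P[/orP[]/eqP-> /orP[]/eqP-> /orP[]/eqP-> _] := ijk;
    by rewrite ?zcc ?zdd ?zcd ?zdc ?scaler0 ?scalerN ?opprK ?subr0 ?sub0r ?add0r
      ?subrr ?addNr.
  rewrite /= andbT !negb_and !negb_or => /or3P[]/andP[lc ld];
  by rewrite ?(z0 _ _ lc ld) ?(z0' _ _ lc ld) ?zXu // ?scaler0 ?subr0.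
have [s ts] := @choice _ _ _ (fun i => quotmod_proj_surj (t i)).
move: (tP c d); rewrite /z !eqxx /= !ts !scale_quotmod_proj -!quotmod_projB.
move=> /in_seq_mul_nil/quotmod_proj_eq0/J_mono/(_ w) wP.
case/negP: wJ; apply: wP; rewrite mcoeff_msupp !mcoeffB mcoeffX eqxx.
have XM k p : w k = 0%N -> ('X_k * p)@_w = 0.
  move=> wk; apply/memN_msupp_eq0; rewrite mulrC (perm_mem (msuppMX _ _)).
  apply/mapP => -[m _ wE]; move/mnmP/(_ k): wE.
  by rewrite wk mnmDE mnm1E eqxx.
by rewrite !XM // !subr0 oner_neq0.
Qed.

(** By [monomial_mccoy], a zero divisor with every variable in its support yields a monomial outside
    [J] that all variables multiply into [J]. *)
Lemma sum_vars_regular :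
  (forall w, 'X_[w] \notin J -> exists i, 'X_[U_(i) + w] \notin J) ->
  forall p, (\sum_i 'X_i) * p \in J -> p \in J.
Proof.
move=> nosocle p lpJ; apply: contraT => pJ.
have [w wJ Xw] := monomial_mccoy J_mono lpJ pJ.
have [i iwJ] := nosocle w wJ; case/negP: iwJ; apply: Xw.
rewrite mcoeff_msupp raddf_sum (bigD1 i) //= mcoeffXU eqxx big1 ?addr0 ?oner_neq0 //.
by move=> j /negPf ji; rewrite mcoeffXU ji.
Qed.

Section FreeVariables.
Variables c d : 'I_N.
Hypothesis cd : c != d.
Hypothesis J_free : forall w w' : 'X_{1..N},
  (forall i, i != c -> i != d -> w i = w' i) -> 'X_[w] \in J -> 'X_[w'] \in J.

Lemma free_var_regular p : 'X_c * p \in J -> p \in J.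
Proof.
move=> XpJ; apply: contraT => pJ.
have [w wJ Xw] := monomial_mccoy J_mono XpJ pJ; case/negP: wJ.
have /J_free : 'X_[U_(c) + w] \in J by apply: Xw; rewrite msuppX mem_head.
by apply=> i ic _; rewrite mnmDE mnm1E eq_sym (negPf ic).
Qed.

Lemma var_subst_ideal e p : p \in J -> var_subst c d e p \in J.
Proof.
move=> /J_mono pJ; rewrite var_substE big_seq; apply: (@rpred_sum _ J) => m /pJ mJ.
rewrite -mul_mpolyC; apply: ideal_mulr; apply: J_free mJ => i ic id.
by rewrite mnm_substE ic (negPf id) mul1n addn0.
Qed.

(** This says that [g] is regular modulo [J] and [f]. Applying the substitution, which kills [g], to
    [g * p - f * q] reduces the claim to regularity of the image of [f] modulo [J]. *)
Lemma free_vars_extend f : (forall p, f * p \in J -> p \in J) ->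
  let g : S := 'X_c - 'X_d ^+ msize f in
  forall p q, g * p - f * q \in J -> exists r, p - f * r \in J.
Proof.
move=> freg; set e := msize f => g p q gpfq.
have greg r : g * r \in J -> r \in J.
  move=> grJ; apply: contraT => rJ.
  have [w wJ Xw] := monomial_mccoy J_mono grJ rJ; case/negP: wJ.
  have /J_free : 'X_[U_(c) + w] \in J.
    apply: Xw; rewrite mcoeff_msupp mcoeffB mpolyXn !mcoeffX eqxx.
    rewrite [_ == U_(c)%MM](_ : _ = false) ?subr0 ?oner_neq0 //.
    by apply/eqP => /mnmP/(_ c); rewrite mulmnE !mnm1E eqxx eq_sym (negPf cd).
  by apply=> i ic _; rewrite mnmDE mnm1E eq_sym (negPf ic).
have [r qr] : exists r, q - g * r \in J.
  have [r rE] := sub_var_subst c d e q; exists r; rewrite -rE opprB addrC subrK.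
  have : var_subst c d e f * var_subst c d e q \in J.
    have : var_subst c d e (g * p - f * q) \in J by apply: var_subst_ideal.
    rewrite var_substB !var_substM var_subst_eq0 // mul0r sub0r.
    by move/(ideal_mulr (-1)); rewrite mulrNN mul1r.
  (* The image of [f] is a nonzerodivisor: the substitution keeps the monomials of [f] apart and
     only alters exponents of X_c and X_d, which do not affect membership in [J]; so a monomial
     killing the image also kills [f]. *)
  move=> fqJ; apply: contraT => qJ.
  have [w wJ Xw] := monomial_mccoy J_mono fqJ qJ.
  suff /freg : f * 'X_[w] \in J by rewrite (negPf wJ).
  apply/J_mono => m; rewrite (perm_mem (msuppMX _ _)) => /mapP[m' m'f ->].
  have := Xw _ (msupp_var_subst (e := e) cd (leqnn _) m'f).
  apply: J_free => i ic id.
  by rewrite mnmDE mnm_substE ic (negPf id) mul1n addn0 [RHS]mnmDE addnC.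
exists r; apply: greg.
have -> : g * (p - f * r) = (g * p - f * q) + f * (q - g * r) by ring.
by apply: (@rpredD _ J) => //; apply: ideal_mulr.
Qed.

End FreeVariables.

End MonomialQuotient.

Section MaxIdeal.
Variables (R : comNzRingType) (N : nat).
Local Notation S := {mpoly R[N]}.
Local Notation mm := (ideal_gen (fun p : S => exists i, p = 'X_i)).

Lemma mem_ideal_gen (G : S -> Prop) p : G p -> p \in ideal_gen G.
Proof.
move=> Gp; apply/asboolP; exists [:: (1, p)]; rewrite big_seq1 mul1r.
by split=> // t; rewrite inE => /eqP->.
Qed.

Lemma max_ideal_gen f : f \in mm -> exists c : 'I_N -> S, f = \sum_i c i * 'X_i.
Proof.
move=> /asboolP[s [sX ->]]; elim: s sX => [|t s IHs] sX.
  by exists (fun=> 0); rewrite big_nil big1 // => i _; rewrite mul0r.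
have [u us|c cE] := IHs; first by apply: sX; rewrite inE us orbT.
have [i ti] := sX t (mem_head _ _).
exists (fun j => c j + if j == i then t.1 else 0).
rewrite big_cons cE addrC ti; under [RHS]eq_bigr do rewrite mulrDl.
rewrite big_split /= [X in _ = _ + X](bigD1 i) //= eqxx.
rewrite [X in _ + (_ + X)]big1 ?addr0 //.
by move=> j /negPf->; rewrite mul0r.
Qed.

Lemma mem_max_ideal (c : 'I_N -> S) : \sum_i c i * 'X_i \in mm.
Proof.
apply: (@rpred_sum _ mm) => i _; apply: (@rpredZ _ S^o mm (c i)).
by apply: mem_ideal_gen; exists i.
Qed.

End MaxIdeal.

(** * The monomials of the powers of I *)

Section MonomialPower.
Variables (R : comNzRingType) (N : nat) (G : seq 'X_{1..N}).
Local Notation S := {mpoly R[N]}.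
Implicit Types (m w g : 'X_{1..N}) (p q : S).

(** Divisibility by a product of [k] elements of [G]; the cofactor is what is left at level 0, where
    every monomial is allowed since I^0 = (1). *)
Fixpoint mono_pow k m : Prop :=
  if k is k'.+1 then exists g w, [/\ g \in G, mono_pow k' w & m = (g + w)%MM]
  else True.

Lemma mono_powD k m w : mono_pow k m -> mono_pow k (w + m)%MM.
Proof.
elim: k m => // k IHk _ [g [m' [gG m'k ->]]]; exists g, (w + m')%MM.
by split=> //; [apply: IHk|rewrite !addmA (addmC g)].
Qed.

Definition genI := ideal_gen (fun p : S => p \in [seq 'X_[g] | g <- G]).

Definition msupp_pow k p := {in msupp p, forall m, mono_pow k m}.

Lemma msupp_powD k p q : msupp_pow k p -> msupp_pow k q -> msupp_pow k (p + q).
Proof. by move=> pk qk m /msuppD_le; rewrite mem_cat => /orP[/pk|/qk]. Qed.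

Lemma msupp_powM k p q : msupp_pow k q -> msupp_pow k (p * q).
Proof.
by move=> qk m /msuppM_le/allpairsP[[m1 m2] [_ /qk m2k ->]]; apply: mono_powD.
Qed.

Lemma msupp_pow0 k : msupp_pow k 0.
Proof. by move=> m; rewrite msupp0. Qed.

Lemma msupp_powMS k p q :
  msupp_pow 1 p -> msupp_pow k q -> msupp_pow k.+1 (p * q).
Proof.
move=> p1 qk m /msuppM_le/allpairsP[[m1 m2] /= [/p1[g [w [gG _ ->]]] /qk m2k ->]].
by exists g, (w + m2)%MM; split=> //; [apply: mono_powD|rewrite addmA].
Qed.

Lemma msupp_pow_genI p : p \in genI -> msupp_pow 1 p.
Proof.
move=> /asboolP[s [sG ->]]; rewrite big_seq.
elim/big_ind: _ => [||t ts]; [exact: msupp_pow0|exact: msupp_powD|].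
have /mapP[g gG ->] := sG t ts; apply: msupp_powM => m.
by rewrite msuppX inE => /eqP->; exists g, 0%MM; rewrite addm0.
Qed.

Lemma msupp_pow_ideal_pow k p : p \in ideal_pow genI k -> msupp_pow k p.
Proof.
move=> /asboolP[s [sG ->]]; rewrite big_seq.
elim/big_ind: _ => [||t ts]; [exact: msupp_pow0|exact: msupp_powD|].
have [u [uI ->]] := sG t ts; apply: msupp_powM => {s sG t ts}.
elim: k u uI => [|k IHk] u uI; first by move=> m _.
by rewrite big_ord_recl; apply: msupp_powMS; [apply: msupp_pow_genI|apply: IHk].
Qed.

Lemma ideal_powS (I : {pred S^o}) k p q :
  p \in I -> q \in ideal_pow I k -> p * q \in ideal_pow I k.+1.
Proof.
move=> pI /asboolP[s [sG ->]]; rewrite mulr_sumr big_seq.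
apply: (@rpred_sum _ (ideal_pow I k.+1)) => t /sG[u [uI ->]].
rewrite mulrCA; apply: (@rpredZ _ S^o (ideal_pow I k.+1) t.1).
apply: mem_ideal_gen; exists (fun i => oapp u p (unlift ord0 i)).
split=> [i|]; first by case: unliftP => [j _|_]; [exact: uI|].
rewrite big_ord_recl unlift_none; congr (_ * _).
by apply: eq_bigr => i _; rewrite liftK.
Qed.

Lemma mpolyX_ideal_pow k m : 'X_[m] \in ideal_pow genI k <-> mono_pow k m.
Proof.
split=> [/msupp_pow_ideal_pow|]; first by apply; rewrite msuppX mem_head.
elim: k m => [|k IHk] m.
  move=> _; rewrite -['X_[m]]mulr1; apply: (@rpredZ _ S^o (ideal_pow genI 0)).
  by apply: mem_ideal_gen; exists (fun=> 0); split=> [[]|] //; rewrite big_ord0.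
move=> [g [w [gG /IHk wk ->]]]; rewrite mpolyXD; apply: ideal_powS => //.
exact/mem_ideal_gen/map_f.
Qed.

Lemma ideal_pow_mono k p :
  p \in ideal_pow genI k <-> {in msupp p, forall m, 'X_[m] \in ideal_pow genI k}.
Proof.
split=> [pk m mp|pk]; first by apply/mpolyX_ideal_pow; apply: msupp_pow_ideal_pow mp.
rewrite [p]mpolyE big_seq; apply: (@rpred_sum _ (ideal_pow genI k)) => m /pk mk.
by rewrite -mul_mpolyC; apply: (@rpredZ _ S^o (ideal_pow genI k)).
Qed.

End MonomialPower.

(** * Counting generators of I in the exponents of a monomial *)

Section ExponentsI.
Variable n : nat.
Local Notation V := 'I_(4 + (n + n)).
Local Notation mnm := 'X_{1..4 + (n + n)}.
Implicit Types (m w g : mnm) (i j : 'I_n) (r s : 'I_n -> nat).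

Definition ia : V := lshift (n + n) (@Ordinal 4 0 isT).
Definition ib : V := lshift (n + n) (@Ordinal 4 1 isT).
Definition ic : V := lshift (n + n) (@Ordinal 4 2 isT).
Definition id_ : V := lshift (n + n) (@Ordinal 4 3 isT).
Definition ix i : V := rshift 4 (lshift n i).
Definition iy i : V := rshift 4 (rshift n i).

Lemma var_ind (P : V -> Prop) : P ia -> P ib -> P ic -> P id_ ->
  (forall i, P (ix i)) -> (forall i, P (iy i)) -> forall v, P v.
Proof.
move=> Pa Pb Pc Pd Px Py v; case: (split_ordP v) => [[k lt4]|u] ->; last first.
  by case: (split_ordP u) => i ->; [exact: Px|exact: Py].
have Pv (w : V) : P w -> val w = k -> P (lshift (n + n) (Ordinal lt4)).
  by move=> Pw wk; rewrite (_ : lshift _ _ = w) //; apply: val_inj.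
case: k lt4 Pv => [|[|[|[|k]]]] lt4 Pv //;
  [exact: Pv Pa _|exact: Pv Pb _|exact: Pv Pc _|exact: Pv Pd _].
Qed.

Lemma var_eqE : ((ia == ib = false) * (ia == ic = false) * (ia == id_ = false)
  * (ib == ia = false) * (ib == ic = false) * (ib == id_ = false)
  * (ic == ia = false) * (ic == ib = false) * (ic == id_ = false)
  * (id_ == ia = false) * (id_ == ib = false) * (id_ == ic = false))
  * ((forall i, ia == ix i = false) * (forall i, ib == ix i = false)
  * (forall i, ic == ix i = false) * (forall i, id_ == ix i = false)
  * (forall i, ix i == ia = false) * (forall i, ix i == ib = false)
  * (forall i, ix i == ic = false) * (forall i, ix i == id_ = false))
  * ((forall i, ia == iy i = false) * (forall i, ib == iy i = false)
  * (forall i, ic == iy i = false) * (forall i, id_ == iy i = false)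
  * (forall i, iy i == ia = false) * (forall i, iy i == ib = false)
  * (forall i, iy i == ic = false) * (forall i, iy i == id_ = false))
  * ((forall i j, ix i == iy j = false) * (forall i j, iy i == ix j = false)
  * (forall i j, (ix i == ix j) = (i == j)) * (forall i j, (iy i == iy j) = (i == j))).
Proof. by do !split => //; move=> *; rewrite /ix /iy ?eq_shift. Qed.

Definition mons : seq mnm :=
  [:: U_(ia) *+ 6; U_(ia) *+ 5 + U_(ib); U_(ia) + U_(ib) *+ 5; U_(ib) *+ 6;
      U_(ia) *+ 4 + U_(ib) *+ 4 + U_(ic); U_(ia) *+ 4 + U_(ib) *+ 4 + U_(id_)]%MM
  ++ [seq (U_(ia) *+ 4 + U_(ix i) + U_(iy i) *+ 2)%MM | i : 'I_n]
  ++ [seq (U_(ib) *+ 4 + U_(ix i) *+ 2 + U_(iy i))%MM | i : 'I_n].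

Lemma gensI_mons (K : fieldType) : gensI K n = [seq 'X_[g] | g <- mons].
Proof.
rewrite /gensI /mons !map_cat /var_a /var_b /var_c /var_d.
rewrite !mpolyXn -!mpolyXD; congr (_ ++ (_ ++ _)); rewrite -map_comp;
  apply: eq_map => i /=;
by rewrite /var_x /var_y !mpolyXn -!mpolyXD.
Qed.

Definition upd r i v : 'I_n -> nat := fun j => if j == i then v else r j.

(** The old value is added on the left to avoid truncated subtraction. *)
Lemma sum_upd r i v :
  (\sum_j upd r i v j + r i = \sum_j r j + v)%N.
Proof.
rewrite (bigD1 i) //= [in RHS](bigD1 i) //= /upd eqxx.
rewrite [X in (v + X)%N](eq_bigr r) => [|j /negPf->] //; lia.
Qed.

(* [m] is divisible by the product of [p] of the generators [a^6], [a^5 b],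
   [a b^5], [b^6], with total exponent [e + 5 f] of [b], and of [qc], [qd],
   [r i], [s i] copies of [a^4 b^4 c], [a^4 b^4 d], [a^4 x_i y_i^2] and
   [b^4 x_i^2 y_i]. *)
Record factors m (p e f qc qd : nat) r s : Prop := Factors {
  fac_e : (e <= p)%N;
  fac_f : (f <= p)%N;
  fac_a : (6 * p + 4 * (qc + qd + \sum_i r i) <= m ia + e + 5 * f)%N;
  fac_b : (e + 5 * f + 4 * (qc + qd + \sum_i s i) <= m ib)%N;
  fac_c : (qc <= m ic)%N;
  fac_d : (qd <= m id_)%N;
  fac_x : forall i, (r i + 2 * s i <= m (ix i))%N;
  fac_y : forall i, (2 * r i + s i <= m (iy i))%N }.

Lemma mons_coordE v :
  ((U_(ia) *+ 6)%MM v = (ia == v) * 6)%N *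
  ((U_(ia) *+ 5 + U_(ib))%MM v = (ia == v) * 5 + (ib == v))%N *
  ((U_(ia) + U_(ib) *+ 5)%MM v = (ia == v) + (ib == v) * 5)%N *
  ((U_(ib) *+ 6)%MM v = (ib == v) * 6)%N *
  (forall u, (U_(ia) *+ 4 + U_(ib) *+ 4 + U_(u))%MM v
    = (ia == v) * 4 + (ib == v) * 4 + (u == v))%N *
  (forall i, (U_(ia) *+ 4 + U_(ix i) + U_(iy i) *+ 2)%MM v
    = (ia == v) * 4 + (ix i == v) + (iy i == v) * 2)%N *
  (forall i, (U_(ib) *+ 4 + U_(ix i) *+ 2 + U_(iy i))%MM v
    = (ib == v) * 4 + (ix i == v) * 2 + (iy i == v))%N.
Proof.
split=> [|i]; last by rewrite 2!mnmDE !mulmnE !mnm1E.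
split=> [|i]; last by rewrite 2!mnmDE !mulmnE !mnm1E.
split=> [|u]; last by rewrite 2!mnmDE !mulmnE !mnm1E.
split; last by rewrite mulmnE mnm1E.
split; last by rewrite mnmDE mulmnE !mnm1E.
split; last by rewrite mnmDE mulmnE !mnm1E.
by rewrite mulmnE mnm1E.
Qed.

(** Each generator raises one of the counts by one; among those counted by [p], a^5 b also raises
    [e], a b^5 raises [f], and b^6 raises both. *)
Lemma factors_mul_mon k g w : g \in mons ->
  (exists p e f qc qd r s, factors w p e f qc qd r s /\
    (p + qc + qd + \sum_i r i + \sum_i s i)%N = k) ->
  exists p e f qc qd r s, factors (g + w)%MM p e f qc qd r s /\
    (p + qc + qd + \sum_i r i + \sum_i s i)%N = k.+1.
Proof.
move=> gG [p [e [f [qc [qd [r [s [[pe pf fa fb fc fd fx fy] <-]]]]]]]].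
move: gG; rewrite !mem_cat !inE => /orP[|/orP[/mapP|/mapP]]; last first.
- move=> [i _ ->]; exists p, e, f, qc, qd, r, (upd s i (s i).+1).
  have := sum_upd s i (s i).+1; set Ss := (\sum_i upd _ _ _ _)%N => SsE.
  split; last lia.
  apply: Factors => [||||||j|j]; rewrite -/Ss ?[(_ + w)%MM _]mnmDE ?mons_coordE ?var_eqE;
    rewrite ?eqxx; try lia.
    have := fx j; rewrite /upd eq_sym; case: eqP => [->|_]; lia.
  have := fy j; rewrite /upd eq_sym; case: eqP => [->|_]; lia.
- move=> [i _ ->]; exists p, e, f, qc, qd, (upd r i (r i).+1), s.
  have := sum_upd r i (r i).+1; set Rs := (\sum_i upd _ _ _ _)%N => RsE.
  split; last lia.
  apply: Factors => [||||||j|j]; rewrite -/Rs ?[(_ + w)%MM _]mnmDE ?mons_coordE ?var_eqE;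
    rewrite ?eqxx; try lia.
    have := fx j; rewrite /upd eq_sym; case: eqP => [->|_]; lia.
  have := fy j; rewrite /upd eq_sym; case: eqP => [->|_]; lia.
move=> /or4P[/eqP->|/eqP->|/eqP->|/or3P[] /eqP->];
  [exists p.+1, e, f, qc, qd, r, s|exists p.+1, e.+1, f, qc, qd, r, s
  |exists p.+1, e, f.+1, qc, qd, r, s|exists p.+1, e.+1, f.+1, qc, qd, r, s
  |exists p, e, f, qc.+1, qd, r, s|exists p, e, f, qc, qd.+1, r, s];
  (split; last lia); apply: Factors => [||||||j|j];
  rewrite ?[(_ + w)%MM _]mnmDE ?mons_coordE ?var_eqE ?eqxx; 
  try (have := fx j; have := fy j); lia.
Qed.

Lemma mono_powS_sub k m g : g \in mons -> (forall v, g v <= m v)%N ->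
  mono_pow mons k (m - g)%MM -> mono_pow mons k.+1 m.
Proof.
move=> gG gm mgk; exists g, (m - g)%MM; split=> //.
by rewrite addmC submK //; apply/mnm_lepP.
Qed.

Lemma factors_mono_pow k m p e f qc qd r s : factors m p e f qc qd r s ->
  (p + qc + qd + \sum_i r i + \sum_i s i)%N = k -> mono_pow mons k m.
Proof.
elim: k m p e f qc qd r s => [//|k IHk] m p e f qc qd r s
  [pe pf fa fb fc fd fx fy] kE.
have ltE i (a : 'I_n -> nat) : (a i <= \sum_i a i)%N.
  by rewrite (bigD1 i) //= leq_addr.
have memG g : g \in take 6 mons -> g \in mons by apply: mem_take.
have [p0|p0] := posnP p; last first.
  (* The generator a^(6 - e0 - 5 f0) b^(e0 + 5 f0) is split off; taking [e0] and [f0] nonzero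
     whenever possible keeps [e - e0] and [f - f0] at most [p.-1]. *)
  pose e0 : nat := (0 < e)%N; pose f0 : nat := (0 < f)%N.
  have [g gG gE] : exists2 g, g \in mons &
      forall v, g v = ((ia == v) * (6 - e0 - 5 * f0) + (ib == v) * (e0 + 5 * f0))%N.
    have : (e0 <= 1)%N && (f0 <= 1)%N by rewrite !leq_b1.
    case: e0 f0 => [|[|//]] [|[|//]] _.
    - by exists (U_(ia) *+ 6)%MM;
        [apply: memG; rewrite !inE eqxx ?orbT|move=> v; rewrite mons_coordE; lia].
    - by exists (U_(ia) + U_(ib) *+ 5)%MM;
        [apply: memG; rewrite !inE eqxx ?orbT|move=> v; rewrite mons_coordE; lia].
    - by exists (U_(ia) *+ 5 + U_(ib))%MM;
        [apply: memG; rewrite !inE eqxx ?orbT|move=> v; rewrite mons_coordE; lia].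
    - by exists (U_(ib) *+ 6)%MM;
        [apply: memG; rewrite !inE eqxx ?orbT|move=> v; rewrite mons_coordE; lia].
  apply: (mono_powS_sub gG).
    by apply: var_ind => *; rewrite gE ?var_eqE ?eqxx; lia.
  apply: (IHk _ p.-1 (e - e0) (f - f0) qc qd r s)%N; last lia.
  apply: Factors => [||||||j|j]; rewrite ?mnmBE ?gE ?var_eqE ?eqxx;
    try (have := fx j; have := fy j); lia.
have [qc0|qc0] := posnP qc; last first.
  have gG : (U_(ia) *+ 4 + U_(ib) *+ 4 + U_(ic))%MM \in mons.
    by apply: memG; rewrite !inE eqxx ?orbT.
  apply: (mono_powS_sub gG).
    by apply: var_ind => *; rewrite mons_coordE ?var_eqE ?eqxx; lia.
  apply: (IHk _ p e f qc.-1 qd r s)%N; last lia.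
  apply: Factors => [||||||j|j]; rewrite ?mnmBE ?mons_coordE ?var_eqE ?eqxx;
    try (have := fx j; have := fy j); lia.
have [qd0|qd0] := posnP qd; last first.
  have gG : (U_(ia) *+ 4 + U_(ib) *+ 4 + U_(id_))%MM \in mons.
    by apply: memG; rewrite !inE eqxx ?orbT.
  apply: (mono_powS_sub gG).
    by apply: var_ind => *; rewrite mons_coordE ?var_eqE ?eqxx; lia.
  apply: (IHk _ p e f qc qd.-1 r s)%N; last lia.
  apply: Factors => [||||||j|j]; rewrite ?mnmBE ?mons_coordE ?var_eqE ?eqxx;
    try (have := fx j; have := fy j); lia.
have [/existsP[i ri]|/existsPn r0] := boolP [exists i, 0 < r i]%N.
  have gG : (U_(ia) *+ 4 + U_(ix i) + U_(iy i) *+ 2)%MM \in mons.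
    by rewrite !mem_cat (map_f (fun i => _ + U_(iy i) *+ 2)%MM) ?mem_enum ?orbT.
  have := ltE i r; have := sum_upd r i (r i).-1.
  set Rs := (\sum_i upd _ _ _ _)%N => RsE rS.
  apply: (mono_powS_sub gG).
    apply: var_ind => [||||j|j]; rewrite mons_coordE ?var_eqE ?eqxx; try lia.
      have := fx j; case: eqP => [<-|_]; lia.
    have := fy j; case: eqP => [<-|_]; lia.
  apply: (IHk _ p e f qc qd (upd r i (r i).-1) s)%N; last by rewrite -/Rs; lia.
  apply: Factors => [||||||j|j]; rewrite -/Rs ?mnmBE ?mons_coordE ?var_eqE ?eqxx; try lia.
    have := fx j; rewrite /upd eq_sym; case: eqP => [<-|_]; lia.
  have := fy j; rewrite /upd eq_sym; case: eqP => [<-|_]; lia.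
have [/existsP[i si]|/existsPn s0] := boolP [exists i, 0 < s i]%N.
  have gG : (U_(ib) *+ 4 + U_(ix i) *+ 2 + U_(iy i))%MM \in mons.
    by rewrite !mem_cat (map_f (fun i => _ + U_(ix i) *+ 2 + _)%MM) ?mem_enum ?orbT.
  have := ltE i s; have := sum_upd s i (s i).-1.
  set Ss := (\sum_i upd _ _ _ _)%N => SsE sS.
  apply: (mono_powS_sub gG).
    apply: var_ind => [||||j|j]; rewrite mons_coordE ?var_eqE ?eqxx; try lia.
      have := fx j; case: eqP => [<-|_]; lia.
    have := fy j; case: eqP => [<-|_]; lia.
  apply: (IHk _ p e f qc qd r (upd s i (s i).-1))%N; last by rewrite -/Ss; lia.
  apply: Factors => [||||||j|j]; rewrite -/Ss ?mnmBE ?mons_coordE ?var_eqE ?eqxx; try lia.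
    have := fx j; rewrite /upd eq_sym; case: eqP => [<-|_]; lia.
  have := fy j; rewrite /upd eq_sym; case: eqP => [<-|_]; lia.
have r00 : (\sum_i r i = 0)%N.
  by apply: big1 => i _; apply/eqP; rewrite -leqn0 leqNgt r0.
have s00 : (\sum_i s i = 0)%N.
  by apply: big1 => i _; apply/eqP; rewrite -leqn0 leqNgt s0.
by move: kE; rewrite p0 qc0 qd0 r00 s00.
Qed.

Lemma mono_pow_factors k m : mono_pow mons k m ->
  exists p e f qc qd r s, factors m p e f qc qd r s /\
    (p + qc + qd + \sum_i r i + \sum_i s i)%N = k.
Proof.
elim: k m => [|k IHk] m.
  move=> _; exists 0%N, 0%N, 0%N, 0%N, 0%N, (fun=> 0%N), (fun=> 0%N).
  by rewrite !big1 //; split=> //; apply: Factors; rewrite ?big1.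
by move=> [g [w [gG /IHk wk ->]]]; apply: factors_mul_mon.
Qed.

End ExponentsI.

Local Open Scope nat_scope.

(** * Witness monomials and reduction of products of generators *)

Section Combinatorics.
Variable n : nat.
Local Notation mnm := 'X_{1..4 + (n + n)}.
Implicit Types (m w : mnm) (i j : 'I_n) (r s : 'I_n -> nat).

(** The default value of [nth] makes the exponents of c and d zero. *)
Definition mnm_of (ea eb : nat) (x y : 'I_n -> nat) : mnm :=
  [multinom match split v with
            | inl u => nth 0 [:: ea; eb] u
            | inr u => match split u with inl i => x i | inr i => y i end
            end | v < 4 + (n + n)].

Lemma mnm_ofE ea eb x y : let w := mnm_of ea eb x y in
  (w (ia n) = ea) * (w (ib n) = eb) * (w (ic n) = 0) * (w (id_ n) = 0) *
  (forall i, w (ix i) = x i) * (forall i, w (iy i) = y i).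
Proof.
have split_l u : split (lshift (n + n) u : 'I_(4 + (n + n))) = inl u.
  exact: (unsplitK (inl u)).
have split_r u : split (rshift 4 u : 'I_(4 + (n + n))) = inr u.
  exact: (unsplitK (inr u)).
have split_x i : split (lshift n i) = inl i by exact: (unsplitK (inl i)).
have split_y i : split (rshift n i) = inr i by exact: (unsplitK (inr i)).
rewrite /=; split=> [|i]; last by rewrite mnmE split_r split_y.
split=> [|i]; last by rewrite mnmE split_r split_x.
by split; [split; [split|]|]; rewrite mnmE split_l.
Qed.

Lemma sum_ltn l : l <= n -> \sum_(i < n) (i < l : nat) = l.
Proof.
move=> ln; rewrite -[RHS]card_ord -sum1_card (big_ord_widen n (fun=> 1)) //.
by rewrite [RHS]big_mkcond; apply: eq_bigr => i _; case: (i < l).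
Qed.

Lemma sum_le_ltn l r : l <= n -> (forall i, r i <= (i < l)) -> \sum_i r i <= l.
Proof. by move=> ln rl; rewrite -[leqRHS](sum_ltn ln); apply: leq_sum => i _. Qed.

Lemma add_var_coordE w v :
  (forall u, (U_(v) + w)%MM u = (v == u) + w u).
Proof. by move=> u; rewrite mnmDE mnm1E. Qed.

Ltac coords := rewrite ?add_var_coordE ?mnm_ofE ?var_eqE ?eqxx.

(* [a^4 b^4] times the product of the [a^4 x_i y_i^2 * b^4 x_i^2 y_i] for [i < l]
   and of the [x_i y_i] for [i >= l]. *)
Definition odd_socle l : mnm :=
  mnm_of (4 * l + 4) (4 * l + 4) (fun i => (i < l) * 2 + 1) (fun i => (i < l) * 2 + 1).

(** The exponents of x and y allow each generator involving them at most once, and only for i < l,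
    so p >= 1; the total degree in a and b gives p <= 2. Then e + 5 f would lie between 2 and 4 if p
    = 1, and be 4 or 8 if p = 2, which e, f <= p excludes. *)
Lemma odd_socle_notin l : l <= n -> ~ mono_pow (mons n) (2 * l + 1) (odd_socle l).
Proof.
move=> ln /mono_pow_factors[p [e [f [qc [qd [r [s [[pe pf fa fb fc fd fx fy] kE]]]]]]]].
rewrite !mnm_ofE in fa fb fc fd; 
have [rl sl] : (forall i, r i <= (i < l)) /\ (forall i, s i <= (i < l)).
  by split=> i; have := fx i; have := fy i; rewrite !mnm_ofE; lia.
have := sum_le_ltn ln rl; have := sum_le_ltn ln sl.
move: fa fb kE; set Rs := \sum_i r i; set Ss := \sum_i s i; lia.
Qed.

(** The spare a^4 b^4 completes a^5 b, a b^5, a^4 b^4 c or a^4 b^4 d when [v] is a, b, c or d. *)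
Lemma odd_socle_mul l v : l <= n ->
  mono_pow (mons n) (2 * l + 1) (U_(v) + odd_socle l)%MM.
Proof.
move=> ln; pose r0 (i : 'I_n) : nat := i < l; have r0E := sum_ltn ln; rewrite -/r0 in r0E.
move: v; apply: var_ind => [||||j|j].
- apply: (@factors_mono_pow n _ _ 1 1 0 0 0 r0 r0); rewrite ?r0E; last lia.
  apply: Factors => [||||||i|i]; coords; rewrite ?r0E /r0; lia.
- apply: (@factors_mono_pow n _ _ 1 0 1 0 0 r0 r0); rewrite ?r0E; last lia.
  apply: Factors => [||||||i|i]; coords; rewrite ?r0E /r0; lia.
- apply: (@factors_mono_pow n _ _ 0 0 0 1 0 r0 r0); rewrite ?r0E; last lia.
  apply: Factors => [||||||i|i]; coords; rewrite ?r0E /r0; lia.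
- apply: (@factors_mono_pow n _ _ 0 0 0 0 1 r0 r0); rewrite ?r0E; last lia.
  apply: Factors => [||||||i|i]; coords; rewrite ?r0E /r0; lia.
(* The extra x_j admits one more b^4 x_j^2 y_j. For j < l it displaces a^4 x_j y_j^2, whose a^4
   together with the spare a^4 contains a^6. For y_j the roles of a and b are exchanged. *)
- have := sum_upd r0 j 0; have := sum_upd r0 j (r0 j).+1; rewrite r0E.
  set Rs := \sum_i upd r0 j 0 i; set Ss := \sum_i upd _ _ _ _ => SsE RsE.
  apply: (@factors_mono_pow n _ _ (j < l) 0 0 0 0 (upd r0 j 0) (upd r0 j (r0 j).+1));
    rewrite -/Rs -/Ss; last by rewrite /r0 in SsE RsE; lia.
  apply: Factors => [||||||i|i]; coords; rewrite -/Rs -/Ss;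
    rewrite /r0 in SsE RsE *; try lia; rewrite /upd eq_sym; case: eqP => [<-|_]; lia.
- have := sum_upd r0 j 0; have := sum_upd r0 j (r0 j).+1; rewrite r0E.
  set Rs := \sum_i upd r0 j 0 i; set Ss := \sum_i upd _ _ _ _ => SsE RsE.
  apply: (@factors_mono_pow n _ _ (j < l) (j < l) (j < l) 0 0
    (upd r0 j (r0 j).+1) (upd r0 j 0));
    rewrite -/Rs -/Ss; last by rewrite /r0 in SsE RsE; lia.
  apply: Factors => [||||||i|i]; coords; rewrite -/Rs -/Ss;
    rewrite /r0 in SsE RsE *; try lia; rewrite /upd eq_sym; case: eqP => [<-|_]; lia.
Qed.

(* Multiplied by [y_l] this is [odd_socle l * (a^4 x_l y_l^2) / (x_l y_l)], whose
   product with any variable other than [y_l] lies in [I^(2 l + 2)]. *)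
Definition even_cocycle l : mnm :=
  mnm_of (4 * l + 8) (4 * l + 4) (fun i => (i < l) * 2 + 1) (fun i => (i < l) * 2 + 1).

Lemma even_cocycle_notin l (ln : l < n) :
  ~ mono_pow (mons n) (2 * l + 2) (U_(iy (Ordinal ln)) + even_cocycle l)%MM.
Proof.
move=> /mono_pow_factors[p [e [f [qc [qd [r [s [[pe pf fa fb fc fd fx fy] kE]]]]]]]].
rewrite !add_var_coordE !mnm_ofE ?var_eqE in fa fb fc fd.
have [rl sl] : (forall i, r i <= (i < l.+1)) /\ (forall i, s i <= (i < l)).
  split=> i; have := fx i; have := fy i; rewrite !add_var_coordE !mnm_ofE !var_eqE;
  rewrite -val_eqE /=; lia.
have := sum_le_ltn ln rl; have := sum_le_ltn (ltnW ln) sl.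
move: fa fb kE; set Rs := \sum_i r i; set Ss := \sum_i s i; lia.
Qed.

(** This provides the second index required by [koszul1_monomial]. Without the extra y_l the
    generator a^4 x_l y_l^2 does not fit, and degrees leave only p = 2 with e + 5 f = 4, a missing
    value. *)
Lemma even_cocycle_c l : l < n ->
  ~ mono_pow (mons n) (2 * l + 2) (U_(ic n) + even_cocycle l)%MM.
Proof.
move=> ln /mono_pow_factors[p [e [f [qc [qd [r [s [[pe pf fa fb fc fd fx fy] kE]]]]]]]].
rewrite !add_var_coordE !mnm_ofE ?var_eqE ?eqxx in fa fb fc fd.
have [rl sl] : (forall i, r i <= (i < l)) /\ (forall i, s i <= (i < l)).
  split=> i; have := fx i; have := fy i; rewrite !add_var_coordE !mnm_ofE !var_eqE; lia.
have := sum_le_ltn (ltnW ln) rl; have := sum_le_ltn (ltnW ln) sl.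
move: fa fb kE; set Rs := \sum_i r i; set Ss := \sum_i s i; lia.
Qed.

Lemma even_cocycle_mul l (ln : l < n) v : v != iy (Ordinal ln) ->
  mono_pow (mons n) (2 * l + 2) (U_(v) + (U_(iy (Ordinal ln)) + even_cocycle l))%MM.
Proof.
pose r0 (i : 'I_n) : nat := i < l.+1; have r0E := sum_ltn ln; rewrite -/r0 in r0E.
pose s0 (i : 'I_n) : nat := i < l; have s0E := sum_ltn (ltnW ln); rewrite -/s0 in s0E.
have oE (j : 'I_n) : (Ordinal ln == j) = (l == j) by rewrite -val_eqE.
move: v; apply: var_ind => [||||j|j] vy.
- apply: (@factors_mono_pow n _ _ 1 1 0 0 0 r0 s0); rewrite ?r0E ?s0E; last lia.
  apply: Factors => [||||||i|i]; coords; rewrite ?r0E ?s0E /r0 /s0 ?oE; lia.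
- apply: (@factors_mono_pow n _ _ 1 0 1 0 0 r0 s0); rewrite ?r0E ?s0E; last lia.
  apply: Factors => [||||||i|i]; coords; rewrite ?r0E ?s0E /r0 /s0 ?oE; lia.
- apply: (@factors_mono_pow n _ _ 0 0 0 1 0 r0 s0); rewrite ?r0E ?s0E; last lia.
  apply: Factors => [||||||i|i]; coords; rewrite ?r0E ?s0E /r0 /s0 ?oE; lia.
- apply: (@factors_mono_pow n _ _ 0 0 0 0 1 r0 s0); rewrite ?r0E ?s0E; last lia.
  apply: Factors => [||||||i|i]; coords; rewrite ?r0E ?s0E /r0 /s0 ?oE; lia.
- have := sum_upd r0 j 0; have := sum_upd s0 j (s0 j).+1; rewrite r0E s0E.
  set Rs := \sum_i upd r0 j 0 i; set Ss := \sum_i upd _ _ _ _ => SsE RsE.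
  rewrite /r0 /s0 in SsE RsE.
  apply: (@factors_mono_pow n _ _ (j < l.+1) 0 0 0 0 (upd r0 j 0) (upd s0 j (s0 j).+1));
    rewrite -/Rs -/Ss; last lia.
  apply: Factors => [||||||i|i]; coords; rewrite -/Rs -/Ss ?oE;
    try lia; rewrite /upd /r0 /s0 eq_sym; case: eqP => [<-|_]; lia.
- rewrite var_eqE eq_sym oE in vy.
  have := sum_upd s0 j 0; have := sum_upd r0 j (r0 j).+1; rewrite r0E s0E.
  set Rs := \sum_i upd r0 j _ i; set Ss := \sum_i upd _ _ _ _ => RsE SsE.
  rewrite /r0 /s0 in SsE RsE.
  apply: (@factors_mono_pow n _ _ (j < l) (j < l) (j < l) 0 0
    (upd r0 j (r0 j).+1) (upd s0 j 0));
    rewrite -/Rs -/Ss; last lia.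
  apply: Factors => [||||||i|i]; coords; rewrite -/Rs -/Ss ?oE;
    try lia; rewrite /upd /r0 /s0 [i == j]eq_sym; case: eqP => [<-|_]; lia.
Qed.

(** Its degree in a and b is 6 k - 1, one too small for [k] of the generators in a and b alone,
    while its x_i y_i admit no other generator free of c and d. *)
Definition large_socle k : mnm := mnm_of (6 * k - 6) 5 (fun=> 1) (fun=> 1).

Lemma large_socle_notin k : 1 < k -> ~ mono_pow (mons n) k (large_socle k).
Proof.
move=> k1 /mono_pow_factors[p [e [f [qc [qd [r [s [[pe pf fa fb fc fd fx fy] kE]]]]]]]].
rewrite !mnm_ofE in fa fb fc fd.
have r0 : \sum_i r i = 0.
  by apply: big1 => i _; have := fx i; have := fy i; rewrite !mnm_ofE; lia.
have s0 : \sum_i s i = 0.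
  by apply: big1 => i _; have := fx i; have := fy i; rewrite !mnm_ofE; lia.
move: fa fb kE; rewrite r0 s0; lia.
Qed.

Lemma large_socle_mul k v : 1 < k -> v != ic n -> v != id_ n ->
  mono_pow (mons n) k (U_(v) + large_socle k)%MM.
Proof.
move=> k1; pose z (i : 'I_n) := 0.
have z0 : \sum_i z i = 0 by apply: big1.
move: v; apply: var_ind => [_ _|_ _|||j _ _|j _ _]; rewrite ?eqxx //.
- apply: (@factors_mono_pow n _ _ k 0 1 0 0 z z); rewrite ?z0; last lia.
  apply: Factors => [||||||i|i]; coords; rewrite ?z0 /z; lia.
- apply: (@factors_mono_pow n _ _ k 1 1 0 0 z z); rewrite ?z0; last lia.
  apply: Factors => [||||||i|i]; coords; rewrite ?z0 /z; lia.
- have := sum_upd z j 1; rewrite z0; set Ss := \sum_i upd _ _ _ _ => SsE.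
  rewrite /z in SsE.
  apply: (@factors_mono_pow n _ _ k.-1 0 0 0 0 z (upd z j 1));
    rewrite ?z0 -/Ss; last lia.
  apply: Factors => [||||||i|i]; coords; rewrite ?z0 -/Ss /z;
    try lia; rewrite /upd eq_sym; case: eqP; lia.
- have := sum_upd z j 1; rewrite z0; set Rs := \sum_i upd _ _ _ _ => RsE.
  rewrite /z in RsE.
  (* One a b^5 occurs among the k - 1 generators, which is possible because 1 < k. *)
  apply: (@factors_mono_pow n _ _ k.-1 0 1 0 0 (upd z j 1) z);
    rewrite ?z0 -/Rs; last lia.
  apply: Factors => [||||||i|i]; coords; rewrite ?z0 -/Rs /z;
    try lia; rewrite /upd eq_sym; case: eqP; lia.
Qed.

(* The relations behind the reduction: [a^6 * a^4 b^4 c], [(a^4 b^4 c)^2] and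
   [(a^4 x y^2)^2 * a^4 b^4 c] are respectively divisible by [(a^5 b)^2],
   [a^6 * b^6] and [(a^6)^2 * b^4 x^2 y], and similarly for their analogues. *)
Lemma factors_normal k m : mono_pow (mons n) k m ->
  exists p e f qc qd r s, [/\ factors m p e f qc qd r s,
    p + qc + qd + \sum_i r i + \sum_i s i = k &
    qc + qd = 0 \/
    [/\ p = 0, qc + qd = 1 & forall i, r i <= 1 /\ s i <= 1]].
Proof.
move=> /mono_pow_factors[p [e [f [qc [qd [r [s [F kE]]]]]]]].
have [N] := ubnP (qc + qd).
elim: N => // N IHN in p e f qc qd r s F kE * => /ltnSE qN.
have [q0|q0] := posnP (qc + qd).
  by exists p, e, f, qc, qd, r, s; split=> //; left.
have [qc' [qd' [qcc qdd qE]]] : exists qc' qd',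
    [/\ qc' <= qc, qd' <= qd & qc' + qd' + 1 = qc + qd].
  case: qc q0 {F kE qN} => [|qc] q0; first by exists 0, qd.-1; split; lia.
  by exists qc, qd; split; lia.
have [pe pf fa fb fc fd fx fy] := F.
have [p0|p0] := posnP p; last first.
  (* Absorbing a^4 b^4 into one more generator must raise e + 5 f by 2 to 4: trading a unit of [e]
     for one of [f] raises it by 4, and if e = 0, setting [e] to 2 raises it by 2; here 2 <= p + 1
     since p > 0. *)
  pose e' := if 0 < e then e.-1 else 2; pose f' := if 0 < e then f.+1 else f.
  have ef : (0 < e /\ e' = e.-1 /\ f' = f.+1) \/ (e = 0 /\ e' = 2 /\ f' = f).
    by rewrite /e' /f'; case: posnP; [right|left].
  apply: (IHN p.+1 e' f' qc' qd' r s); [|lia|lia].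
  by apply: Factors => //; lia.
have [q2|q2] := leqP 2 (qc + qd).
  have [qc2 [qd2 [qcc2 qdd2 qE2]]] : exists qc2 qd2,
      [/\ qc2 <= qc, qd2 <= qd & qc2 + qd2 + 2 = qc + qd].
    (* Two factors are removed, first from [qc], with any remainder taken from [qd]. *)
    by exists (qc - 2), (qd - (2 - qc)); split; lia.
  apply: (IHN 2 1 1 qc2 qd2 r s); [|lia|lia].
  by apply: Factors => //; lia.
have [/existsP[j rj]|/existsPn r1] := boolP [exists j, 1 < r j].
  have := sum_upd r j (r j - 2); have := sum_upd s j (s j).+1.
  set Ss := \sum_i upd s _ _ _; set Rs := \sum_i upd r _ _ _ => SsE RsE.
  have rS : r j <= \sum_i r i by rewrite (bigD1 j) //= leq_addr.
  apply: (IHN 2 0 0 qc' qd' (upd r j (r j - 2)) (upd s j (s j).+1));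
    rewrite -?/Rs -?/Ss; [|lia|lia].
  apply: Factors => [||||||i|i]; rewrite -?/Rs -?/Ss; try lia;
    have := fx i; have := fy i; rewrite /upd; case: eqP => [->|_]; lia.
have [/existsP[j sj]|/existsPn s1] := boolP [exists j, 1 < s j].
  have := sum_upd s j (s j - 2); have := sum_upd r j (r j).+1.
  set Rs := \sum_i upd r _ _ _; set Ss := \sum_i upd s _ _ _ => RsE SsE.
  have sS : s j <= \sum_i s i by rewrite (bigD1 j) //= leq_addr.
  apply: (IHN 2 2 2 qc' qd' (upd r j (r j).+1) (upd s j (s j - 2)));
    rewrite -?/Rs -?/Ss; [|lia|lia].
  apply: Factors => [||||||i|i]; rewrite -?/Rs -?/Ss; try lia;
    have := fx i; have := fy i; rewrite /upd; case: eqP => [->|_]; lia.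
exists p, e, f, qc, qd, r, s; split=> //; right; split=> // [|i]; first lia.
by split; rewrite leqNgt ?r1 ?s1.
Qed.

(** In the normal form, a factor containing c or d forces k = 1 + sum r + sum s <= 2 n + 1. *)
Lemma mono_pow_free_cd k w w' : 2 * n + 1 < k ->
  (forall v, v != ic n -> v != id_ n -> w v = w' v) ->
  mono_pow (mons n) k w -> mono_pow (mons n) k w'.
Proof.
move=> nk ww' /factors_normal[p [e [f [qc [qd [r [s [F kE qP]]]]]]]].
have [pe pf fa fb fc fd fx fy] := F.
case: qP => [q0|[p0 q1 rs1]].
  apply: (@factors_mono_pow n _ _ p e f 0 0 r s); last lia.
  have [wa wb] : w (ia n) = w' (ia n) /\ w (ib n) = w' (ib n).
    by split; apply: ww'; rewrite var_eqE.
  by apply: Factors => [||||||i|i]; try lia; rewrite -ww' ?var_eqE.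
have rn : \sum_i r i <= n by apply: sum_le_ltn => // i; rewrite ltn_ord; case: (rs1 i).
have sn : \sum_i s i <= n by apply: sum_le_ltn => // i; rewrite ltn_ord; case: (rs1 i).
exfalso; move: kE; set Rs := \sum_i r i; set Ss := \sum_i s i; lia.
Qed.

Lemma even_no_socle k w : ~~ odd k -> ~ mono_pow (mons n) k w ->
  exists v, ~ mono_pow (mons n) k (U_(v) + w)%MM.
Proof.
move=> kev wk; apply: contrapT => /forallNP allin.
have inI v : mono_pow (mons n) k (U_(v) + w)%MM by apply: contrapT; apply: allin.
have [p [e [f [qc [qd [r [s [F kE qP]]]]]]]] := factors_normal (inI (ic n)).
have [pe pf fa fb fc fd fx fy] := F.
have wxE i : (U_(ic n) + w)%MM (ix i) = w (ix i) by rewrite add_var_coordE var_eqE.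
have wyE i : (U_(ic n) + w)%MM (iy i) = w (iy i) by rewrite add_var_coordE var_eqE.
rewrite !add_var_coordE !var_eqE ?eqxx in fa fb fc fd.
case: qP => [q0|[p0 q1 rs1]].
  apply: wk; apply: (@factors_mono_pow n _ _ p e f 0 0 r s); last lia.
  by apply: Factors => [||||||i|i]; rewrite -?wxE -?wyE //; lia.
(* Otherwise r_i = s_i for all [i], and k = 1 + 2 sum r is odd. *)
have [i ri] : exists i, r i + s i = 1.
  apply: contrapT => /forallNP no; move: kev; rewrite -kE p0 -addnA -big_split /=.
  have -> : \sum_i (r i + s i) = 2 * \sum_i r i.
    rewrite big_distrr; apply: eq_bigr => i _ /=.
    have := no i; have [] := rs1 i; lia.
  by rewrite q1; lia.
have [[ri1 si0]|[ri0 si1]] : r i = 1 /\ s i = 0 \/ r i = 0 /\ s i = 1 by lia.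
  (* With x_i^2 dividing [w], a^4 x_i y_i^2 could be exchanged for b^4 x_i^2 y_i, and the released
     a^4 with the a^4 of the dropped c or d factor would supply a^6. *)
  have ix1 : w (ix i) = 1.
    apply/eqP; rewrite eqn_leq; apply/andP; split; last first.
      by have := fx i; rewrite wxE; lia.
    rewrite leqNgt; apply/negP => ix2; apply: wk.
    have := sum_upd r i 0; have := sum_upd s i 1.
    set Ss := \sum_i upd s _ _ _; set Rs := \sum_i upd r _ _ _ => SsE RsE.
    apply: (@factors_mono_pow n _ _ 1 0 0 0 0 (upd r i 0) (upd s i 1));
      rewrite -?/Rs -?/Ss; last lia.
    apply: Factors => [||||||j|j]; rewrite -?/Rs -?/Ss; try lia;
      have := fx j; have := fy j; rewrite ?wxE ?wyE /upd; case: eqP => [->|_]; lia.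
  (* As x_i occurs only once, a factorization of y_i w uses at most y_i^2, which already divides
     [w]. *)
  have [p' [e' [f' [qc' [qd' [r' [s' [[pe' pf' fa' fb' fc' fd' fx' fy'] kE']]]]]]]] :=
    mono_pow_factors (inI (iy i)).
  apply: wk; apply: (@factors_mono_pow n _ _ p' e' f' qc' qd' r' s' _ kE').
  rewrite !add_var_coordE !var_eqE in fa' fb' fc' fd'.
  apply: Factors => // j; have := fx' j; have := fy' j;
    rewrite !add_var_coordE !var_eqE //.
  by case: eqP => [<-|_]; have := fy i; have := fx i; rewrite ?wxE ?wyE; lia.
  have iy1 : w (iy i) = 1.
    apply/eqP; rewrite eqn_leq; apply/andP; split; last first.
      by have := fy i; rewrite wyE; lia.
    rewrite leqNgt; apply/negP => iy2; apply: wk.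
    have := sum_upd r i 1; have := sum_upd s i 0.
    set Ss := \sum_i upd s _ _ _; set Rs := \sum_i upd r _ _ _ => SsE RsE.
    apply: (@factors_mono_pow n _ _ 1 1 1 0 0 (upd r i 1) (upd s i 0));
      rewrite -?/Rs -?/Ss; last lia.
    apply: Factors => [||||||j|j]; rewrite -?/Rs -?/Ss; try lia;
      have := fx j; have := fy j; rewrite ?wxE ?wyE /upd; case: eqP => [->|_]; lia.
  have [p' [e' [f' [qc' [qd' [r' [s' [[pe' pf' fa' fb' fc' fd' fx' fy'] kE']]]]]]]] :=
    mono_pow_factors (inI (ix i)).
  apply: wk; apply: (@factors_mono_pow n _ _ p' e' f' qc' qd' r' s' _ kE').
  rewrite !add_var_coordE !var_eqE in fa' fb' fc' fd'.
  apply: Factors => // j; have := fx' j; have := fy' j;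
    rewrite !add_var_coordE !var_eqE //.
  by case: eqP => [<-|_]; have := fy i; have := fx i; rewrite ?wxE ?wyE; lia.
Qed.

End Combinatorics.

(** * Depth *)

Section DepthOfPowers.
Local Open Scope ring_scope.
Variables (K : fieldType) (n : nat).
Local Notation S := (polyS K n).
Local Notation J k := (ideal_pow (idealI K n) k).

Lemma ideal_pow_idealI_mono k (p : S) :
  p \in J k <-> {in msupp p, forall m, 'X_[m] \in J k}.
Proof. rewrite /idealI gensI_mons; exact: ideal_pow_mono. Qed.

Lemma mpolyX_idealI k m : 'X_[m] \in J k <-> mono_pow (mons n) k m.
Proof. rewrite /idealI gensI_mons; exact: mpolyX_ideal_pow. Qed.

Lemma mpolyX_idealIN k m : 'X_[m] \notin J k <-> ~ mono_pow (mons n) k m.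
Proof. by rewrite -mpolyX_idealI; split=> /negP. Qed.

Lemma depth_odd l : (l <= n)%N -> depth_quot_pow K n (2 * l + 1) 0.
Proof.
move=> ln; apply: (has_depth0 (@max_ideal_gen K (4 + (n + n)))).
apply: (koszul0_monomial (w := odd_socle n l)) => [|v].
  exact/mpolyX_idealIN/odd_socle_notin.
exact/mpolyX_idealI/odd_socle_mul.
Qed.

Lemma depth_even l : (l < n)%N -> depth_quot_pow K n (2 * l + 2) 1.
Proof.
move=> ln; apply: (has_depth1 (@max_ideal_gen K (4 + (n + n))) (f := \sum_i 'X_i)).
- apply: (koszul1_monomial (@ideal_pow_idealI_mono _)
    (i := iy (Ordinal ln)) (w := even_cocycle n l)) => [|v vy|].
  + exact/mpolyX_idealIN/even_cocycle_notin.
  + exact/mpolyX_idealI/even_cocycle_mul.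
  + by exists (ic n); rewrite ?var_eqE //; apply/mpolyX_idealIN/even_cocycle_c.
- have := mem_max_ideal (fun=> 1 : S).
  by under eq_bigr do rewrite mul1r.
apply: nonzerodivisor_quot; apply: (sum_vars_regular (@ideal_pow_idealI_mono _)).
move=> w /mpolyX_idealIN wJ.
have [|v vw] := even_no_socle _ wJ; first by lia.
by exists v; apply/mpolyX_idealIN.
Qed.

Lemma depth_large k : (2 * n + 1 < k)%N -> depth_quot_pow K n k 2.
Proof.
move=> nk; have cd : ic n != id_ n by rewrite var_eqE.
have free (w w' : 'X_{1..4 + (n + n)}) :
    (forall i, i != ic n -> i != id_ n -> w i = w' i) ->
    'X_[w] \in J k -> 'X_[w'] \in J k.
  by move=> ww' /mpolyX_idealI wJ; apply/mpolyX_idealI; apply: mono_pow_free_cd ww' wJ.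
have mX (v : 'I_(4 + (n + n))) e : ('X_v ^+ e.+1 : S) \in max_ideal K n.
  rewrite exprSr; apply: (@rpredZ _ S^o (max_ideal K n)).
  by apply: mem_ideal_gen; exists v.
have k1 : (1 < k)%N by lia.
apply: (has_depth2 (@max_ideal_gen K (4 + (n + n))) (f := 'X_(ic n))).
- apply: (koszul2_monomial (@ideal_pow_idealI_mono _) (w := large_socle n k) cd)
    => [|||v vc vd]; rewrite ?mnm_ofE //.
    exact/mpolyX_idealIN/large_socle_notin.
  exact/mpolyX_idealI/large_socle_mul.
- by rewrite -['X_ _]expr1.
- apply: nonzerodivisor_quot.
  exact: (free_var_regular (@ideal_pow_idealI_mono _) (d := id_ n) free).
move=> f fm /nonzerodivisor_quotE fr.
exists ('X_(ic n) - 'X_(id_ n) ^+ msize f).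
  apply: (ideal_memB (J := max_ideal K n)); first exact: (mX _ 0).
  (* X_d^0 = 1 is not in the maximal ideal; but [msize f = 0] means f = 0, and regularity of 0 would
     put 1 in I^k. *)
  case sz: (msize f) => [|e]; last exact: mX.
  move: sz => /eqP; rewrite msize_poly_eq0 => /eqP f0.
  have : (1 : S) \in J k by apply: fr; rewrite f0 mul0r; apply: (@rpred0 _ (J k)).
  rewrite -[1]mpolyX0 => /mpolyX_idealI/mono_pow_factors.
  move=> [p [e [f' [qc [qd [r [s [[pe pf fa fb _ _ _ _] kE]]]]]]]].
  by move: fa fb kE; rewrite !mnm0E; lia.
have := free_vars_extend (@ideal_pow_idealI_mono _) cd free fr.
move=> ext v; have [p ->] := quotmod_proj_surj v.
rewrite scale_quotmod_proj => /in_seq_mul1_quot[q /ext ?].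
exact/in_seq_mul1_quot.
Qed.

End DepthOfPowers.

Theorem theorem0p1 (K : fieldType) (n : nat) :
  (forall k : nat, 1 <= k ->
     [/\ odd k -> k <= 2 * n + 1 -> depth_quot_pow K n k 0,
         ~~ odd k -> k <= 2 * n -> depth_quot_pow K n k 1
       & 2 * n + 1 < k -> depth_quot_pow K n k 2]) /\
  (forall f : nat -> nat, (forall k : nat, 1 <= k -> depth_quot_pow K n k (f k)) ->
     exists s : seq nat,
       [/\ uniq s, size s = n & forall k : nat, k \in s <-> strict_local_max f k]).
Proof.
have dodd k : odd k -> k <= 2 * n + 1 -> depth_quot_pow K n k 0.
  move=> kodd kn; have -> : k = (2 * k./2 + 1)%N by lia.
  by apply: depth_odd; lia.
have deven k : 0 < k -> ~~ odd k -> k <= 2 * n -> depth_quot_pow K n k 1.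
  move=> k0 kev kn; have -> : k = (2 * (k./2).-1 + 2)%N by lia.
  by apply: depth_even; lia.
split=> [k k0|f fP].
  by split; [apply: dodd|apply: deven|apply: depth_large].
have f0 k : odd k -> k <= 2 * n + 1 -> f k = 0.
  by move=> kodd kn; apply: has_depth_inj (fP k _) (dodd k kodd kn); lia.
have f1 k : 0 < k -> ~~ odd k -> k <= 2 * n -> f k = 1.
  by move=> k0 kev kn; apply: has_depth_inj (fP k k0) (deven k k0 kev kn).
have f2 k : 2 * n + 1 < k -> f k = 2.
  by move=> nk; apply: has_depth_inj (fP k _) (depth_large K nk); lia.
(* The values are 0, 1, 0, ..., 1, 0 up to 2 n + 1 and constantly 2 afterwards, so the peaks are the
   even numbers from 2 to 2 n. *)
exists [seq 2 * i.+1 | i <- iota 0 n]; split.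
- by rewrite map_inj_uniq ?iota_uniq // => i j; lia.
- by rewrite size_map size_iota.
move=> k; split=> [/mapP[i]|[k2 up down]].
  rewrite mem_iota => /andP[_ ilt] ->.
  split; first lia.
    by rewrite f0 ?f1; lia.
  by rewrite f0 ?f1; lia.
have [kn|nk] := leqP k (2 * n + 1); last by rewrite !f2 in down; lia.
have [kodd|kev] := boolP (odd k); first by rewrite (f0 k) in down; lia.
by apply/mapP; exists (k./2).-1; rewrite ?mem_iota; lia.
Qed.
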